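(* Let $\Bbbk$ be a field of characteristic zero, $X=\{x_1,\dots,x_n\}$, and let $\Psi=\Psi(x_1,\dots,x_n)\in\operatorname{AC}(X)$ be a nonzero Jacobian AC-polynomial. Then either $n=2$ and $\Psi=\alpha C_2$, or $n=3$ and $\Psi=\alpha J_3$, for some $\alpha\in\Bbbk^*=\Bbbk\setminus\{0\}$, where $$C_2=\{x_1,x_2\},\qquad J_3=\{\{x_1,x_2\},x_3\}+\{\{x_2,x_3\},x_1\}+\{\{x_3,x_1\},x_2\}.$$
   Context: A generic Poisson algebra (GP-algebra) over $\Bbbk$ is a $\Bbbk$-linear space with a bilinear associative and commutative product $xy$, a bilinear anti-commutative bracket $\{x,y\}$ (no Jacobi identity is required), and a multiplicative identity $1$, satisfying the Leibniz identity $\{x,yz\}=\{x,y\}z+\{x,z\}y$. $\operatorname{GP}(X)$ is the free GP-algebra generated by $X$. $\operatorname{AC}(X)$ is the free anti-commutative (nonassociative) algebra generated by $X$, with operation denoted $\{\cdot,\cdot\}$; as a linear space $\operatorname{GP}(X)\cong S(\operatorname{AC}(X))$ (symmetric algebra), and in particular $\operatorname{AC}(X)\subset\operatorname{GP}(X)$. Elements of $\operatorname{AC}(X)$ are called AC-polynomials. An element of $\operatorname{AC}(x_1,\dots,x_n)$ or $\operatorname{GP}(x_1,\dots,x_n)$ is polylinear if it is linear in each of $x_1,\dots,x_n$ (each variable occurs exactly once in each of its monomials). An element $\Psi(x_1,\dots,x_n)\in\operatorname{GP}(x_1,\dots,x_n)$ linear in $x_n$ is a derivation with respect to $x_n$ if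 $$\Psi(x_1,\dots,x_{n-1},yz)=y\,\Psi(x_1,\dots,x_{n-1},z)+z\,\Psi(x_1,\dots,x_{n-1},y)$$ in the free GP-algebra $\operatorname{GP}(x_1,\dots,x_{n-1},y,z)$; similarly for the other variables. A polylinear AC-polynomial $\Psi(x_1,\dots,x_n)$ is called a Jacobian AC-polynomial if it is a derivation with respect to each variable $x_i$, $i=1,\dots,n$. *)

(* Defs.v *)
From HB Require Import structures.
From mathcomp Require Import all_boot all_algebra.
From mathcomp Require Import generic_quotient boolp.

Set Implicit Arguments.
Unset Strict Implicit.
Unset Printing Implicit Defensive.

Import GRing.Theory.
Local Open Scope ring_scope.
Local Open Scope quotient_scope.

(* Anti-commutativity is {x,y} = - {y,x}; it agrees with {x,x} = 0 as soon as
   2 is invertible. Linearity in the second argument is [bracket_linearr]. *)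
HB.mixin Record Lmodule_hasBracket (k : fieldType) A of GRing.Lmodule k A := {
  bracket : A -> A -> A;
  bracketC : forall x y, bracket x y = - bracket y x;
  bracket_linearl : forall (a : k) x y z,
    bracket (a *: x + y) z = a *: bracket x z + bracket y z }.

#[short(type="acAlgType")]
HB.structure Definition ACAlgebra (k : fieldType) :=
  {A of Lmodule_hasBracket k A & GRing.Lmodule k A}.

HB.mixin Record Bracket_isLeibniz (k : fieldType) A
    of ACAlgebra k A & GRing.ComAlgebra k A := {
  bracket_leibniz : forall x y z : A,
    bracket x (y * z) = bracket x y * z + bracket x z * y }.

#[short(type="gpAlgType")]
HB.structure Definition GPAlgebra (k : fieldType) :=
  {A of ACAlgebra k A & GRing.ComAlgebra k A & Bracket_isLeibniz k A}.

Lemma bracket_linearr (k : fieldType) (A : acAlgType k) (a : k) (x y z : A) :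
  bracket z (a *: x + y) = a *: bracket z x + bracket z y.
Proof. by rewrite bracketC bracket_linearl opprD -scalerN -!(bracketC z). Qed.

(* The free algebras are term algebras modulo the congruence generated by the
   axioms of the variety; [boolp] makes the congruence a boolean relation. *)
Section FreeAC.
Variables (k : fieldType) (X : Type).

Inductive ac_term : Type :=
| ACvar of X
| ACzero
| ACadd of ac_term & ac_term
| ACscale of k & ac_term
| ACbr of ac_term & ac_term.

Inductive ac_eq : ac_term -> ac_term -> Prop :=
| ac_eq_refl s : ac_eq s s
| ac_eq_sym s t : ac_eq s t -> ac_eq t s
| ac_eq_trans s t u : ac_eq s t -> ac_eq t u -> ac_eq s u
| ac_eq_add s s' t t' :
    ac_eq s s' -> ac_eq t t' -> ac_eq (ACadd s t) (ACadd s' t')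
| ac_eq_scale a s s' : ac_eq s s' -> ac_eq (ACscale a s) (ACscale a s')
| ac_eq_br s s' t t' :
    ac_eq s s' -> ac_eq t t' -> ac_eq (ACbr s t) (ACbr s' t')
| ac_eq_addA s t u : ac_eq (ACadd s (ACadd t u)) (ACadd (ACadd s t) u)
| ac_eq_addC s t : ac_eq (ACadd s t) (ACadd t s)
| ac_eq_add0 s : ac_eq (ACadd ACzero s) s
| ac_eq_addN s : ac_eq (ACadd (ACscale (-1) s) s) ACzero
| ac_eq_scaleA a b s : ac_eq (ACscale a (ACscale b s)) (ACscale (a * b) s)
| ac_eq_scale1 s : ac_eq (ACscale 1 s) s
| ac_eq_scaleDr a s t :
    ac_eq (ACscale a (ACadd s t)) (ACadd (ACscale a s) (ACscale a t))
| ac_eq_scaleDl a b s :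
    ac_eq (ACscale (a + b) s) (ACadd (ACscale a s) (ACscale b s))
| ac_eq_brC s t : ac_eq (ACbr s t) (ACscale (-1) (ACbr t s))
| ac_eq_brD s t u : ac_eq (ACbr (ACadd s t) u) (ACadd (ACbr s u) (ACbr t u))
| ac_eq_brZ a s t : ac_eq (ACbr (ACscale a s) t) (ACscale a (ACbr s t)).

HB.instance Definition _ := gen_eqMixin ac_term.
HB.instance Definition _ := gen_choiceMixin ac_term.

Definition ac_rel : rel ac_term := fun s t => `[< ac_eq s t >].

Fact ac_rel_refl : reflexive ac_rel.
Proof. by move=> s; apply/asboolP; exact: ac_eq_refl. Qed.

Fact ac_rel_sym : symmetric ac_rel.
Proof.
by move=> s t; apply/asboolP/asboolP; exact: ac_eq_sym.
Qed.

Fact ac_rel_trans : transitive ac_rel.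
Proof.
by move=> t s u /asboolP st /asboolP tu; apply/asboolP; exact: ac_eq_trans tu.
Qed.

Canonical ac_equiv := EquivRel ac_rel ac_rel_refl ac_rel_sym ac_rel_trans.

Definition freeAC := {eq_quot ac_equiv}.
HB.instance Definition _ := Choice.on freeAC.
HB.instance Definition _ := EqQuotient.on freeAC.

Definition ac_pi (s : ac_term) : freeAC := \pi_freeAC s.

Lemma ac_reprK (u : freeAC) : ac_pi (repr u) = u.
Proof. exact: reprK. Qed.

Lemma ac_ind (P : freeAC -> Prop) : (forall s, P (ac_pi s)) -> forall u, P u.
Proof. by move=> Ppi u; rewrite -[u]ac_reprK. Qed.

Lemma ac_piP (s t : ac_term) : ac_pi s = ac_pi t <-> ac_eq s t.
Proof.
split=> [/eqmodP/asboolP //|st]; apply/eqmodP; exact/asboolP.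
Qed.

Lemma ac_reprP (s : ac_term) : ac_eq (repr (ac_pi s)) s.
Proof. by apply/ac_piP; rewrite ac_reprK. Qed.

Definition ac_var (x : X) : freeAC := ac_pi (ACvar x).
Definition ac_zero : freeAC := ac_pi ACzero.
Definition ac_add (u v : freeAC) : freeAC := ac_pi (ACadd (repr u) (repr v)).
Definition ac_scale (a : k) (u : freeAC) : freeAC := ac_pi (ACscale a (repr u)).
Definition ac_opp (u : freeAC) : freeAC := ac_scale (-1) u.
Definition ac_br (u v : freeAC) : freeAC := ac_pi (ACbr (repr u) (repr v)).

Lemma pi_ac_add s t : ac_pi (ACadd s t) = ac_add (ac_pi s) (ac_pi t).
Proof. by apply/ac_piP/ac_eq_add; apply/ac_eq_sym/ac_reprP. Qed.

Lemma pi_ac_scale a s : ac_pi (ACscale a s) = ac_scale a (ac_pi s).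
Proof. by apply/ac_piP/ac_eq_scale; apply/ac_eq_sym/ac_reprP. Qed.

Lemma pi_ac_br s t : ac_pi (ACbr s t) = ac_br (ac_pi s) (ac_pi t).
Proof. by apply/ac_piP/ac_eq_br; apply/ac_eq_sym/ac_reprP. Qed.

Local Opaque ac_pi ac_add ac_scale ac_br.

Let piE := (pi_ac_add, pi_ac_scale, pi_ac_br).

Fact ac_addA : associative ac_add.
Proof.
elim/ac_ind=> s; elim/ac_ind=> t; elim/ac_ind=> u.
by rewrite -!piE; apply/ac_piP/ac_eq_addA.
Qed.

Fact ac_addC : commutative ac_add.
Proof.
by elim/ac_ind=> s; elim/ac_ind=> t; rewrite -!piE; apply/ac_piP/ac_eq_addC.
Qed.

Fact ac_add0 : left_id ac_zero ac_add.
Proof. by elim/ac_ind=> s; rewrite -!piE; apply/ac_piP/ac_eq_add0. Qed.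

Fact ac_addN : left_inverse ac_zero ac_opp ac_add.
Proof.
by elim/ac_ind=> s; rewrite /ac_opp -!piE; apply/ac_piP/ac_eq_addN.
Qed.

HB.instance Definition _ :=
  GRing.isZmodule.Build freeAC ac_addA ac_addC ac_add0 ac_addN.

Lemma ac_piD s t : ac_pi (ACadd s t) = ac_pi s + ac_pi t.
Proof. exact: pi_ac_add. Qed.

Fact ac_scaleA a b (u : freeAC) : ac_scale a (ac_scale b u) = ac_scale (a * b) u.
Proof. by elim/ac_ind: u => s; rewrite -!piE; apply/ac_piP/ac_eq_scaleA. Qed.

Fact ac_scale1 : left_id 1 ac_scale.
Proof. by elim/ac_ind=> s; rewrite -!piE; apply/ac_piP/ac_eq_scale1. Qed.

Fact ac_scaleDr : right_distributive ac_scale +%R.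
Proof.
move=> a; elim/ac_ind=> s; elim/ac_ind=> t.
by rewrite -ac_piD -!pi_ac_scale -ac_piD; apply/ac_piP/ac_eq_scaleDr.
Qed.

Fact ac_scaleDl u : {morph ac_scale^~ u : a b / a + b}.
Proof.
move=> a b; elim/ac_ind: u => s.
by rewrite -!pi_ac_scale -ac_piD; apply/ac_piP/ac_eq_scaleDl.
Qed.

HB.instance Definition _ :=
  GRing.Zmodule_isLmodule.Build k freeAC ac_scaleA ac_scale1 ac_scaleDr ac_scaleDl.

Lemma ac_piZ a s : ac_pi (ACscale a s) = a *: ac_pi s.
Proof. exact: pi_ac_scale. Qed.

Fact ac_brC (u v : freeAC) : ac_br u v = - ac_br v u.
Proof.
elim/ac_ind: u => s; elim/ac_ind: v => t; rewrite -scaleN1r -!pi_ac_br -ac_piZ.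
exact/ac_piP/ac_eq_brC.
Qed.

Fact ac_br_linearl (a : k) (u v w : freeAC) :
  ac_br (a *: u + v) w = a *: ac_br u w + ac_br v w.
Proof.
elim/ac_ind: u => s; elim/ac_ind: v => t; elim/ac_ind: w => r.
rewrite -ac_piZ -ac_piD -!pi_ac_br -ac_piZ -ac_piD; apply/ac_piP.
by apply: ac_eq_trans (ac_eq_brD _ _ _) (ac_eq_add (ac_eq_brZ _ _ _) (ac_eq_refl _)).
Qed.

HB.instance Definition _ :=
  Lmodule_hasBracket.Build k freeAC ac_brC ac_br_linearl.

Lemma ac_pi_br s t : ac_pi (ACbr s t) = bracket (ac_pi s) (ac_pi t).
Proof. exact: pi_ac_br. Qed.

Section Lift.
Variables (A : acAlgType k) (f : X -> A).

Fixpoint ac_eval (t : ac_term) : A :=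
  match t with
  | ACvar x => f x
  | ACzero => 0
  | ACadd s t => ac_eval s + ac_eval t
  | ACscale a s => a *: ac_eval s
  | ACbr s t => bracket (ac_eval s) (ac_eval t)
  end.

Lemma ac_eval_eq s t : ac_eq s t -> ac_eval s = ac_eval t.
Proof.
elim=> {s t} //=.
- by move=> s t u _ -> _ ->.
- by move=> s s' t t' _ -> _ ->.
- by move=> a s s' _ ->.
- by move=> s s' t t' _ -> _ ->.
- by move=> *; rewrite addrA.
- by move=> *; rewrite addrC.
- by move=> *; rewrite add0r.
- by move=> *; rewrite scaleN1r addNr.
- by move=> *; rewrite scalerA.
- by move=> *; rewrite scale1r.
- by move=> *; rewrite scalerDr.
- by move=> *; rewrite scalerDl.
- by move=> *; rewrite scaleN1r -bracketC.
- by move=> s t u; rewrite -[ac_eval s]scale1r bracket_linearl !scale1r.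
- move=> a s t; rewrite -[a *: _]addr0 bracket_linearl.
  suff -> : bracket 0 (ac_eval t) = 0 by rewrite addr0.
  have := bracket_linearl 1 0 0 (ac_eval t).
  by rewrite !scale1r addr0 => /eqP; rewrite -subr_eq0 opprD addNKr oppr_eq0 => /eqP.
Qed.

Definition ac_lift (u : freeAC) : A := ac_eval (repr u).

Lemma ac_lift_pi s : ac_lift (ac_pi s) = ac_eval s.
Proof. exact/ac_eval_eq/ac_reprP. Qed.

Lemma ac_lift_var x : ac_lift (ac_var x) = f x.
Proof. exact: ac_lift_pi. Qed.

Fact ac_lift_is_linear : linear ac_lift.
Proof.
move=> a; elim/ac_ind=> s; elim/ac_ind=> t.
by rewrite -ac_piZ -ac_piD !ac_lift_pi.
Qed.
HB.instance Definition _ :=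
  GRing.isLinear.Build k freeAC A *:%R ac_lift ac_lift_is_linear.

Lemma ac_lift_br u v : ac_lift (bracket u v) = bracket (ac_lift u) (ac_lift v).
Proof.
by elim/ac_ind: u => s; elim/ac_ind: v => t; rewrite -ac_pi_br !ac_lift_pi.
Qed.

Lemma ac_lift_unique (g : {linear freeAC -> A}) :
  {morph g : u v / bracket u v} -> (forall x, g (ac_var x) = f x) ->
  g =1 ac_lift.
Proof.
move=> gbr gvar; elim/ac_ind=> s; rewrite ac_lift_pi.
elim: s => [x||s IHs t IHt|a s IHs|s IHs t IHt] /=.
- exact: gvar.
- exact: (raddf0 g).
- by rewrite ac_piD linearD /= IHs IHt.
- by rewrite ac_piZ linearZ /= IHs.
- by rewrite ac_pi_br gbr IHs IHt.
Qed.
End Lift.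
End FreeAC.

Section FreeGP.
Variables (k : fieldType) (X : Type).

Inductive gp_term : Type :=
| GPvar of X
| GPzero
| GPone
| GPadd of gp_term & gp_term
| GPscale of k & gp_term
| GPmul of gp_term & gp_term
| GPbr of gp_term & gp_term.

Inductive gp_eq : gp_term -> gp_term -> Prop :=
| gp_eq_refl s : gp_eq s s
| gp_eq_sym s t : gp_eq s t -> gp_eq t s
| gp_eq_trans s t u : gp_eq s t -> gp_eq t u -> gp_eq s u
| gp_eq_add s s' t t' :
    gp_eq s s' -> gp_eq t t' -> gp_eq (GPadd s t) (GPadd s' t')
| gp_eq_scale a s s' : gp_eq s s' -> gp_eq (GPscale a s) (GPscale a s')
| gp_eq_mul s s' t t' :
    gp_eq s s' -> gp_eq t t' -> gp_eq (GPmul s t) (GPmul s' t')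
| gp_eq_br s s' t t' :
    gp_eq s s' -> gp_eq t t' -> gp_eq (GPbr s t) (GPbr s' t')
| gp_eq_addA s t u : gp_eq (GPadd s (GPadd t u)) (GPadd (GPadd s t) u)
| gp_eq_addC s t : gp_eq (GPadd s t) (GPadd t s)
| gp_eq_add0 s : gp_eq (GPadd GPzero s) s
| gp_eq_addN s : gp_eq (GPadd (GPscale (-1) s) s) GPzero
| gp_eq_scaleA a b s : gp_eq (GPscale a (GPscale b s)) (GPscale (a * b) s)
| gp_eq_scale1 s : gp_eq (GPscale 1 s) s
| gp_eq_scaleDr a s t :
    gp_eq (GPscale a (GPadd s t)) (GPadd (GPscale a s) (GPscale a t))
| gp_eq_scaleDl a b s :
    gp_eq (GPscale (a + b) s) (GPadd (GPscale a s) (GPscale b s))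
| gp_eq_mulA s t u : gp_eq (GPmul s (GPmul t u)) (GPmul (GPmul s t) u)
| gp_eq_mulC s t : gp_eq (GPmul s t) (GPmul t s)
| gp_eq_mul1 s : gp_eq (GPmul GPone s) s
| gp_eq_mulD s t u :
    gp_eq (GPmul (GPadd s t) u) (GPadd (GPmul s u) (GPmul t u))
| gp_eq_mulZ a s t : gp_eq (GPmul (GPscale a s) t) (GPscale a (GPmul s t))
| gp_eq_brC s t : gp_eq (GPbr s t) (GPscale (-1) (GPbr t s))
| gp_eq_brD s t u : gp_eq (GPbr (GPadd s t) u) (GPadd (GPbr s u) (GPbr t u))
| gp_eq_brZ a s t : gp_eq (GPbr (GPscale a s) t) (GPscale a (GPbr s t))
| gp_eq_leibniz s t u :
    gp_eq (GPbr s (GPmul t u)) (GPadd (GPmul (GPbr s t) u) (GPmul (GPbr s u) t)).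

HB.instance Definition _ := gen_eqMixin gp_term.
HB.instance Definition _ := gen_choiceMixin gp_term.

Definition gp_rel : rel gp_term := fun s t => `[< gp_eq s t >].

Fact gp_rel_refl : reflexive gp_rel.
Proof. by move=> s; apply/asboolP; exact: gp_eq_refl. Qed.

Fact gp_rel_sym : symmetric gp_rel.
Proof. by move=> s t; apply/asboolP/asboolP; exact: gp_eq_sym. Qed.

Fact gp_rel_trans : transitive gp_rel.
Proof.
by move=> t s u /asboolP st /asboolP tu; apply/asboolP; exact: gp_eq_trans tu.
Qed.

Canonical gp_equiv := EquivRel gp_rel gp_rel_refl gp_rel_sym gp_rel_trans.

Definition freeGP := {eq_quot gp_equiv}.
HB.instance Definition _ := Choice.on freeGP.
HB.instance Definition _ := EqQuotient.on freeGP.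

Definition gp_pi (s : gp_term) : freeGP := \pi_freeGP s.

Lemma gp_reprK (u : freeGP) : gp_pi (repr u) = u.
Proof. exact: reprK. Qed.

Lemma gp_ind (P : freeGP -> Prop) : (forall s, P (gp_pi s)) -> forall u, P u.
Proof. by move=> Ppi u; rewrite -[u]gp_reprK. Qed.

Lemma gp_piP (s t : gp_term) : gp_pi s = gp_pi t <-> gp_eq s t.
Proof.
split=> [/eqmodP/asboolP //|st]; apply/eqmodP; exact/asboolP.
Qed.

Lemma gp_reprP (s : gp_term) : gp_eq (repr (gp_pi s)) s.
Proof. by apply/gp_piP; rewrite gp_reprK. Qed.

Definition gp_var (x : X) : freeGP := gp_pi (GPvar x).
Definition gp_zero : freeGP := gp_pi GPzero.
Definition gp_one : freeGP := gp_pi GPone.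
Definition gp_add (u v : freeGP) : freeGP := gp_pi (GPadd (repr u) (repr v)).
Definition gp_scale (a : k) (u : freeGP) : freeGP := gp_pi (GPscale a (repr u)).
Definition gp_opp (u : freeGP) : freeGP := gp_scale (-1) u.
Definition gp_mul (u v : freeGP) : freeGP := gp_pi (GPmul (repr u) (repr v)).
Definition gp_br (u v : freeGP) : freeGP := gp_pi (GPbr (repr u) (repr v)).

Lemma pi_gp_add s t : gp_pi (GPadd s t) = gp_add (gp_pi s) (gp_pi t).
Proof. by apply/gp_piP/gp_eq_add; apply/gp_eq_sym/gp_reprP. Qed.

Lemma pi_gp_scale a s : gp_pi (GPscale a s) = gp_scale a (gp_pi s).
Proof. by apply/gp_piP/gp_eq_scale; apply/gp_eq_sym/gp_reprP. Qed.

Lemma pi_gp_mul s t : gp_pi (GPmul s t) = gp_mul (gp_pi s) (gp_pi t).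
Proof. by apply/gp_piP/gp_eq_mul; apply/gp_eq_sym/gp_reprP. Qed.

Lemma pi_gp_br s t : gp_pi (GPbr s t) = gp_br (gp_pi s) (gp_pi t).
Proof. by apply/gp_piP/gp_eq_br; apply/gp_eq_sym/gp_reprP. Qed.

Local Opaque gp_pi gp_add gp_scale gp_mul gp_br.

Let piE := (pi_gp_add, pi_gp_scale, pi_gp_mul, pi_gp_br).

Fact gp_addA : associative gp_add.
Proof.
elim/gp_ind=> s; elim/gp_ind=> t; elim/gp_ind=> u.
by rewrite -!piE; apply/gp_piP/gp_eq_addA.
Qed.

Fact gp_addC : commutative gp_add.
Proof.
by elim/gp_ind=> s; elim/gp_ind=> t; rewrite -!piE; apply/gp_piP/gp_eq_addC.
Qed.

Fact gp_add0 : left_id gp_zero gp_add.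
Proof. by elim/gp_ind=> s; rewrite -!piE; apply/gp_piP/gp_eq_add0. Qed.

Fact gp_addN : left_inverse gp_zero gp_opp gp_add.
Proof.
by elim/gp_ind=> s; rewrite /gp_opp -!piE; apply/gp_piP/gp_eq_addN.
Qed.

HB.instance Definition _ :=
  GRing.isZmodule.Build freeGP gp_addA gp_addC gp_add0 gp_addN.

Lemma gp_piD s t : gp_pi (GPadd s t) = gp_pi s + gp_pi t.
Proof. exact: pi_gp_add. Qed.

Fact gp_mulA : associative gp_mul.
Proof.
elim/gp_ind=> s; elim/gp_ind=> t; elim/gp_ind=> u.
by rewrite -!piE; apply/gp_piP/gp_eq_mulA.
Qed.

Fact gp_mulC : commutative gp_mul.
Proof.
by elim/gp_ind=> s; elim/gp_ind=> t; rewrite -!piE; apply/gp_piP/gp_eq_mulC.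
Qed.

Fact gp_mul1 : left_id gp_one gp_mul.
Proof. by elim/gp_ind=> s; rewrite -!piE; apply/gp_piP/gp_eq_mul1. Qed.

Fact gp_mulD : left_distributive gp_mul +%R.
Proof.
elim/gp_ind=> s; elim/gp_ind=> t; elim/gp_ind=> u.
by rewrite -gp_piD -!pi_gp_mul -gp_piD; apply/gp_piP/gp_eq_mulD.
Qed.

(* Sends every generator to 0, with zero bracket: shows that 1 != 0. *)
Fixpoint gp_const (t : gp_term) : k :=
  match t with
  | GPvar _ | GPzero | GPbr _ _ => 0
  | GPone => 1
  | GPadd s t => gp_const s + gp_const t
  | GPscale a s => a * gp_const s
  | GPmul s t => gp_const s * gp_const t
  end.

Lemma gp_const_eq s t : gp_eq s t -> gp_const s = gp_const t.
Proof.
elim=> {s t} //=.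
- by move=> s t u _ -> _ ->.
- by move=> s s' t t' _ -> _ ->.
- by move=> a s s' _ ->.
- by move=> s s' t t' _ -> _ ->.
- by move=> *; rewrite addrA.
- by move=> *; rewrite addrC.
- by move=> *; rewrite add0r.
- by move=> *; rewrite mulN1r addNr.
- by move=> *; rewrite mulrA.
- by move=> *; rewrite mul1r.
- by move=> *; rewrite mulrDr.
- by move=> *; rewrite mulrDl.
- by move=> *; rewrite mulrA.
- by move=> *; rewrite mulrC.
- by move=> *; rewrite mul1r.
- by move=> *; rewrite mulrDl.
- by move=> *; rewrite mulrA.
- by move=> *; rewrite mulr0.
- by move=> *; rewrite addr0.
- by move=> *; rewrite mulr0.
- by move=> *; rewrite !mul0r addr0.
Qed.

Fact gp_one_neq0 : gp_one != 0.
Proof.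
by apply/eqP=> /gp_piP/gp_const_eq/= /eqP; rewrite oner_eq0.
Qed.

HB.instance Definition _ :=
  GRing.Zmodule_isComNzRing.Build freeGP gp_mulA gp_mulC gp_mul1 gp_mulD gp_one_neq0.

Lemma gp_piM s t : gp_pi (GPmul s t) = gp_pi s * gp_pi t.
Proof. exact: pi_gp_mul. Qed.

Fact gp_scaleA a b (u : freeGP) : gp_scale a (gp_scale b u) = gp_scale (a * b) u.
Proof. by elim/gp_ind: u => s; rewrite -!piE; apply/gp_piP/gp_eq_scaleA. Qed.

Fact gp_scale1 : left_id 1 gp_scale.
Proof. by elim/gp_ind=> s; rewrite -!piE; apply/gp_piP/gp_eq_scale1. Qed.

Fact gp_scaleDr : right_distributive gp_scale +%R.
Proof.
move=> a; elim/gp_ind=> s; elim/gp_ind=> t.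
by rewrite -gp_piD -!pi_gp_scale -gp_piD; apply/gp_piP/gp_eq_scaleDr.
Qed.

Fact gp_scaleDl u : {morph gp_scale^~ u : a b / a + b}.
Proof.
move=> a b; elim/gp_ind: u => s.
by rewrite -!pi_gp_scale -gp_piD; apply/gp_piP/gp_eq_scaleDl.
Qed.

HB.instance Definition _ :=
  GRing.Zmodule_isLmodule.Build k freeGP gp_scaleA gp_scale1 gp_scaleDr gp_scaleDl.

Lemma gp_piZ a s : gp_pi (GPscale a s) = a *: gp_pi s.
Proof. exact: pi_gp_scale. Qed.

Fact gp_scaleAl (a : k) (u v : freeGP) : a *: (u * v) = (a *: u) * v.
Proof.
elim/gp_ind: u => s; elim/gp_ind: v => t.
by rewrite -gp_piM -!gp_piZ -gp_piM; apply/gp_piP/gp_eq_sym/gp_eq_mulZ.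
Qed.

HB.instance Definition _ := GRing.Lmodule_isLalgebra.Build k freeGP gp_scaleAl.
HB.instance Definition _ := GRing.Lalgebra_isComAlgebra.Build k freeGP.

Fact gp_brC (u v : freeGP) : gp_br u v = - gp_br v u.
Proof.
elim/gp_ind: u => s; elim/gp_ind: v => t; rewrite -scaleN1r -!pi_gp_br -gp_piZ.
exact/gp_piP/gp_eq_brC.
Qed.

Fact gp_br_linearl (a : k) (u v w : freeGP) :
  gp_br (a *: u + v) w = a *: gp_br u w + gp_br v w.
Proof.
elim/gp_ind: u => s; elim/gp_ind: v => t; elim/gp_ind: w => r.
rewrite -gp_piZ -gp_piD -!pi_gp_br -gp_piZ -gp_piD; apply/gp_piP.
by apply: gp_eq_trans (gp_eq_brD _ _ _) (gp_eq_add (gp_eq_brZ _ _ _) (gp_eq_refl _)).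
Qed.

HB.instance Definition _ :=
  Lmodule_hasBracket.Build k freeGP gp_brC gp_br_linearl.

Lemma gp_pi_br s t : gp_pi (GPbr s t) = bracket (gp_pi s) (gp_pi t).
Proof. exact: pi_gp_br. Qed.

Fact gp_br_leibniz (u v w : freeGP) :
  bracket u (v * w) = bracket u v * w + bracket u w * v.
Proof.
elim/gp_ind: u => s; elim/gp_ind: v => t; elim/gp_ind: w => r.
rewrite -gp_piM -!gp_pi_br -!gp_piM -gp_piD; apply/gp_piP.
exact: gp_eq_leibniz.
Qed.

HB.instance Definition _ := Bracket_isLeibniz.Build k freeGP gp_br_leibniz.

Section Lift.
Variables (A : gpAlgType k) (f : X -> A).

Fixpoint gp_eval (t : gp_term) : A :=
  match t with
  | GPvar x => f x
  | GPzero => 0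
  | GPone => 1
  | GPadd s t => gp_eval s + gp_eval t
  | GPscale a s => a *: gp_eval s
  | GPmul s t => gp_eval s * gp_eval t
  | GPbr s t => bracket (gp_eval s) (gp_eval t)
  end.

Lemma gp_eval_eq s t : gp_eq s t -> gp_eval s = gp_eval t.
Proof.
elim=> {s t} //=.
- by move=> s t u _ -> _ ->.
- by move=> s s' t t' _ -> _ ->.
- by move=> a s s' _ ->.
- by move=> s s' t t' _ -> _ ->.
- by move=> s s' t t' _ -> _ ->.
- by move=> *; rewrite addrA.
- by move=> *; rewrite addrC.
- by move=> *; rewrite add0r.
- by move=> *; rewrite scaleN1r addNr.
- by move=> *; rewrite scalerA.
- by move=> *; rewrite scale1r.
- by move=> *; rewrite scalerDr.
- by move=> *; rewrite scalerDl.
- by move=> *; rewrite mulrA.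
- by move=> *; rewrite mulrC.
- by move=> *; rewrite mul1r.
- by move=> *; rewrite mulrDl.
- by move=> *; rewrite scalerAl.
- by move=> *; rewrite scaleN1r -bracketC.
- by move=> s t u; rewrite -[gp_eval s]scale1r bracket_linearl !scale1r.
- move=> a s t; rewrite -[a *: _]addr0 bracket_linearl.
  suff -> : bracket 0 (gp_eval t) = 0 by rewrite addr0.
  have := bracket_linearl 1 0 0 (gp_eval t).
  by rewrite !scale1r addr0 => /eqP; rewrite -subr_eq0 opprD addNKr oppr_eq0 => /eqP.
- by move=> *; rewrite bracket_leibniz.
Qed.

Definition gp_lift (u : freeGP) : A := gp_eval (repr u).

Lemma gp_lift_pi s : gp_lift (gp_pi s) = gp_eval s.
Proof. exact/gp_eval_eq/gp_reprP. Qed.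

Lemma gp_lift_var x : gp_lift (gp_var x) = f x.
Proof. exact: gp_lift_pi. Qed.

Fact gp_lift_is_linear : linear gp_lift.
Proof.
move=> a; elim/gp_ind=> s; elim/gp_ind=> t.
by rewrite -gp_piZ -gp_piD !gp_lift_pi.
Qed.
HB.instance Definition _ :=
  GRing.isLinear.Build k freeGP A *:%R gp_lift gp_lift_is_linear.

Fact gp_lift_is_monoid_morphism : monoid_morphism gp_lift.
Proof.
split; first exact: (gp_lift_pi GPone).
by elim/gp_ind=> s; elim/gp_ind=> t; rewrite -gp_piM !gp_lift_pi.
Qed.
HB.instance Definition _ :=
  GRing.isMonoidMorphism.Build freeGP A gp_lift gp_lift_is_monoid_morphism.

Lemma gp_lift_br u v : gp_lift (bracket u v) = bracket (gp_lift u) (gp_lift v).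
Proof.
by elim/gp_ind: u => s; elim/gp_ind: v => t; rewrite -gp_pi_br !gp_lift_pi.
Qed.

Lemma gp_lift_unique (g : {lrmorphism freeGP -> A}) :
  {morph g : u v / bracket u v} -> (forall x, g (gp_var x) = f x) ->
  g =1 gp_lift.
Proof.
move=> gbr gvar; elim/gp_ind=> s; rewrite gp_lift_pi.
elim: s => [x|||s IHs t IHt|a s IHs|s IHs t IHt|s IHs t IHt] /=.
- exact: gvar.
- exact: (raddf0 g).
- exact: (rmorph1 g).
- by rewrite gp_piD linearD /= IHs IHt.
- by rewrite gp_piZ linearZ /= IHs.
- by rewrite gp_piM rmorphM /= IHs IHt.
- by rewrite gp_pi_br gbr IHs IHt.
Qed.
End Lift.
End FreeGP.

(* The canonical map AC(X) -> GP(X), through which AC-polynomials are regarded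
   as elements of GP(X). *)
Definition ac_to_gp (k : fieldType) (X : Type) : freeAC k X -> freeGP k X :=
  ac_lift (@gp_var k X).

Section Multilinearity.
Variables (k : fieldType) (X : eqType).

Inductive ac_mono : Type :=
| ACMvar of X
| ACMbr of ac_mono & ac_mono.

Fixpoint ac_mono_val (w : ac_mono) : freeAC k X :=
  match w with
  | ACMvar x => ac_var k x
  | ACMbr v w => bracket (ac_mono_val v) (ac_mono_val w)
  end.

Fixpoint ac_mono_deg (x : X) (w : ac_mono) : nat :=
  match w with
  | ACMvar y => (x == y)
  | ACMbr v w => ac_mono_deg x v + ac_mono_deg x w
  end%N.

Definition polylinear (F : freeAC k X) : Prop :=
  exists (r : nat) (c : 'I_r -> k) (w : 'I_r -> ac_mono),
    (forall i x, ac_mono_deg x (w i) = 1%N) /\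
    F = \sum_(i < r) c i *: ac_mono_val (w i).

Inductive gp_mono : Type :=
| GPMone
| GPMvar of X
| GPMmul of gp_mono & gp_mono
| GPMbr of gp_mono & gp_mono.

Fixpoint gp_mono_val (w : gp_mono) : freeGP k X :=
  match w with
  | GPMone => 1
  | GPMvar x => gp_var k x
  | GPMmul v w => gp_mono_val v * gp_mono_val w
  | GPMbr v w => bracket (gp_mono_val v) (gp_mono_val w)
  end.

Fixpoint gp_mono_deg (x : X) (w : gp_mono) : nat :=
  match w with
  | GPMone => 0
  | GPMvar y => (x == y)
  | GPMmul v w | GPMbr v w => gp_mono_deg x v + gp_mono_deg x w
  end%N.

Definition linear_in (x : X) (F : freeGP k X) : Prop :=
  exists (r : nat) (c : 'I_r -> k) (w : 'I_r -> gp_mono),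
    (forall i, gp_mono_deg x (w i) = 1%N) /\
    F = \sum_(i < r) c i *: gp_mono_val (w i).
End Multilinearity.

Section Jacobian.
Variables (k : fieldType) (X : eqType).

(* The variables X \ {x} together with two new ones, y and z. *)
Definition split_var (x : X) : Type := ({u : X | u != x} + bool)%type.

Definition gp_y (x : X) : freeGP k (split_var x) := gp_var k (inr false).
Definition gp_z (x : X) : freeGP k (split_var x) := gp_var k (inr true).

(* F(..., x := w, ...), the other variables being left unchanged. *)
Definition gp_subst (x : X) (w : freeGP k (split_var x)) :
    freeGP k X -> freeGP k (split_var x) :=
  gp_lift (fun u => if insub u is Some v then gp_var k (inl v) else w).

Definition derivation_wrt (x : X) (F : freeGP k X) : Prop :=
  linear_in x F /\
  gp_subst (gp_y x * gp_z x) F =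
    gp_y x * gp_subst (gp_z x) F + gp_z x * gp_subst (gp_y x) F.

Definition jacobian (Psi : freeAC k X) : Prop :=
  polylinear Psi /\ forall x : X, derivation_wrt x (ac_to_gp Psi).
End Jacobian.

Definition C2 (k : fieldType) : freeAC k 'I_2 :=
  let x1 := ac_var k (0 : 'I_2) in
  let x2 := ac_var k (1 : 'I_2) in
  bracket x1 x2.

Definition J3 (k : fieldType) : freeAC k 'I_3 :=
  let x1 := ac_var k (0 : 'I_3) in
  let x2 := ac_var k (1 : 'I_3) in
  let x3 := ac_var k (2%:R : 'I_3) in
  bracket (bracket x1 x2) x3 + bracket (bracket x2 x3) x1
    + bracket (bracket x3 x1) x2.

(* Main.v *)
From HB Require Import structures.
Require Import Defs.
From mathcomp Require Import all_boot all_algebra.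
From mathcomp Require Import boolp functions perm ring zify.

Set Implicit Arguments.
Unset Strict Implicit.
Unset Printing Implicit Defensive.

Import GRing.Theory.
Local Open Scope ring_scope.

(** An AC-polynomial linear in x is T(x) for a unique T in the tensor algebra on
    the AC-monomials a free of x, a word a_1 ... a_d standing for the operator
    x |-> {...{{x, a_1}, a_2}, ..., a_d}. By the Leibniz rule, T(y z) is the
    unshuffle coproduct of T applied to y and z, so Psi = T(x) is a derivation
    with respect to x exactly when T is primitive. Dually, the coefficients of T
    add up to 0 over the shuffles of any two nonempty words
    ([jacobian_shuffle]). This is read off by an evaluation in the
    GP-algebra S(V) / S^(>= 3)(V), with V the space of functions on planar trees
    ([trunc]).

    A functional on words that vanishes on shuffles is determined by its values
    on the words that begin with one given letter ([shuffle_vanishing]; for Lie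
    elements this is the basis of left normed brackets that begin with that
    letter). This is used twice.

    Let Psi have a nonzero coefficient at {...{x, a_1}, ..., a_d} with d as large
    as possible. If some a_i were not a leaf, then the coefficient would be
    nonzero at a word that begins with a_i, and {...{x, a_i}, ...} contains a
    path longer than d. So all a_i are variables, the tree is a comb, and
    d = n - 1 ([coeff_comb_neq0]).

    Next, let c(x; w) be the coefficient of the comb with innermost letter x and
    further letters w. As functions of w, c(x; w) and -c(y; w) with x in place of
    y agree on the words that begin with y, by antisymmetry of {x, y}; hence they
    agree everywhere ([comb_swap_root]). So c is alternating in all n letters
    ([comb_alternating]). For n - 1 >= 3, the shuffle relation of two letters
    with the other ones then reads m c = 0, with m = floor((n - 1) / 2) a positive
    integer ([comb_size]). Hence n <= 3.

    The case n = 1 is impossible since y z <> 2 y z ([jacobian_var]). For n = 2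
    and n = 3 every monomial is a comb up to flips, a polylinear element is
    determined by its coefficients ([polylinear_inj]), and the coefficients of
    C_2 and J_3 are alternating as well. *)

(** * Coordinates on AC(X) and a quadratic truncation of S(AC(X)) *)
Section Coefficients.
Variables (k : fieldType) (X : eqType).
Local Notation tree := (ac_mono X).

(** Coordinates indexed by all planar trees: no representatives of trees up to
    flips have to be chosen, at the price of redundant coordinates. *)
Definition coef := tree -> k^o.
HB.instance Definition _ := GRing.Lmodule.on coef.

(** Dual to the cobracket that cuts a tree at its root and antisymmetrizes. *)
Definition coef_br (f g : coef) : coef := fun t =>
  if t is ACMbr p q then f p * g q - f q * g p else 0.

Fact coef_brC f g : coef_br f g = - coef_br g f.
Proof. by apply/funext=> -[y|p q]; rewrite opprfctE /= ?oppr0 //; ring. Qed.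

Fact coef_br_linearl (a : k) (f g h : coef) :
  coef_br (a *: f + g) h = a *: coef_br f h + coef_br g h.
Proof.
apply/funext=> -[y|p q]; rewrite !addrfctE !scalrfctE /= ?scaler0 ?addr0 //.
by rewrite /GRing.scale /=; ring.
Qed.

HB.instance Definition _ :=
  Lmodule_hasBracket.Build k coef coef_brC coef_br_linearl.

(** The GP-algebra S(V) / S^(>= 3)(V) for V = [coef], that is k + V + S^2(V), a
    symmetric tensor of degree 2 being a function of two trees. The part of
    degree at least 3 is an ideal for both operations because the bracket of
    S^i and S^j lies in S^(i+j-1). Degree 2 is what sees a product y z put in
    place of a variable of an AC-polynomial. *)
Definition trunc := (k^o * coef * (tree -> coef))%type.
HB.instance Definition _ := GRing.Lmodule.on trunc.

Definition sym_mul (f g : coef) : tree -> coef :=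
  fun s t => f s * g t + f t * g s.

(** The extension of [coef_br f] to S^2(V) as a derivation: it acts on each of
    the two tensor factors. *)
Definition sym_der (f : coef) (Q : tree -> coef) : tree -> coef :=
  fun s t => coef_br f (Q^~ t) s + coef_br f (Q s) t.

Definition trunc_one : trunc := (1, fun=> 0, fun _ _ => 0).

Definition trunc_mul (a b : trunc) : trunc :=
  (a.1.1 * b.1.1, a.1.1 *: b.1.2 + b.1.1 *: a.1.2,
   a.1.1 *: b.2 + b.1.1 *: a.2 + sym_mul a.1.2 b.1.2).

Definition trunc_br (a b : trunc) : trunc :=
  (0, coef_br a.1.2 b.1.2, sym_der a.1.2 b.2 - sym_der b.1.2 a.2).

Local Ltac fctE :=
  repeat progress (rewrite ?(addrfctE, scalrfctE, opprfctE) /=);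
  rewrite /GRing.scale /=.
Local Ltac trunc_ext := congr (_, _, _);
  [ | apply/funext=> r | apply/funext=> s; apply/funext=> t ].

Fact trunc_mulA : associative trunc_mul.
Proof.
move=> [[a f] P] [[b g] Q] [[c h] R]; rewrite /trunc_mul /sym_mul /=.
by trunc_ext; fctE; ring.
Qed.

Fact trunc_mulC : commutative trunc_mul.
Proof.
move=> [[a f] P] [[b g] Q]; rewrite /trunc_mul /sym_mul /=.
by trunc_ext; fctE; ring.
Qed.

Fact trunc_mul1 : left_id trunc_one trunc_mul.
Proof.
move=> [[a f] P]; rewrite /trunc_mul /sym_mul /=.
by trunc_ext; fctE; ring.
Qed.

Fact trunc_mulD : left_distributive trunc_mul +%R.
Proof.
move=> [[a f] P] [[b g] Q] [[c h] R]; rewrite /trunc_mul /sym_mul /=.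
by trunc_ext; fctE; ring.
Qed.

Fact trunc_one_neq0 : trunc_one != 0.
Proof. by apply/eqP=> -[/eqP]; rewrite oner_eq0. Qed.

HB.instance Definition _ :=
  GRing.Zmodule_isComNzRing.Build trunc trunc_mulA trunc_mulC trunc_mul1
    trunc_mulD trunc_one_neq0.

Fact trunc_scaleAl (c : k) (a b : trunc) : c *: (a * b) = (c *: a) * b.
Proof.
move: a b => [[a f] P] [[b g] Q].
rewrite /GRing.mul /= /trunc_mul /sym_mul /=.
by trunc_ext; fctE; ring.
Qed.

HB.instance Definition _ :=
  GRing.Lmodule_isLalgebra.Build k trunc trunc_scaleAl.
HB.instance Definition _ := GRing.Lalgebra_isComAlgebra.Build k trunc.

Fact trunc_brC (a b : trunc) : trunc_br a b = - trunc_br b a.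
Proof.
rewrite /trunc_br /= /sym_der; trunc_ext.
- by rewrite oppr0.
- by rewrite coef_brC.
- by fctE; rewrite opprB.
Qed.

Fact trunc_br_linearl (c : k) (a b d : trunc) :
  trunc_br (c *: a + b) d = c *: trunc_br a d + trunc_br b d.
Proof.
move: a b d => [[a f] P] [[b g] Q] [[d h] R].
rewrite /trunc_br /sym_der /=; trunc_ext.
- by fctE; ring.
- by case: r => [y|p q]; fctE; ring.
- by case: s => [y|p q]; case: t => [y'|p' q']; fctE; ring.
Qed.

HB.instance Definition _ :=
  Lmodule_hasBracket.Build k trunc trunc_brC trunc_br_linearl.

Fact trunc_br_leibniz (a b c : trunc) :
  bracket a (b * c) = bracket a b * c + bracket a c * b.
Proof.
move: a b c => [[a f] P] [[b g] Q] [[c h] R].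
rewrite /GRing.mul /bracket /= /trunc_br /trunc_mul /sym_der /sym_mul /=.
trunc_ext.
- by fctE; ring.
- by case: r => [y|p q]; fctE; ring.
- by case: s => [y|p q]; case: t => [y'|p' q']; fctE; ring.
Qed.
HB.instance Definition _ := Bracket_isLeibniz.Build k trunc trunc_br_leibniz.
End Coefficients.

(** * Shuffles of words *)

Section Shuffles.
Variables (T : Type).
Implicit Types (u v w : seq T) (a b : T).

Fixpoint shuffles u v : seq (seq T) :=
  if u is a :: u' then
    (fix shuffles_u v :=
      if v is b :: v' then
        map (cons a) (shuffles u' v) ++ map (cons b) (shuffles_u v')
      else [:: u]) v
  else [:: v].

Lemma shuffles0r u : shuffles u [::] = [:: u].
Proof. by case: u. Qed.

Lemma shuffles0l u : shuffles [::] u = [:: u].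
Proof. by []. Qed.

Lemma shuffles_cons a u b v :
  shuffles (a :: u) (b :: v) =
  map (cons a) (shuffles u (b :: v)) ++ map (cons b) (shuffles (a :: u) v).
Proof. by []. Qed.

#[local] Arguments shuffles : simpl never.

Lemma sum_shuffles_cons (V : nmodType) (g : seq T -> V) a u b v :
  \sum_(w <- shuffles (a :: u) (b :: v)) g w =
  \sum_(w <- shuffles u (b :: v)) g (a :: w)
    + \sum_(w <- shuffles (a :: u) v) g (b :: w).
Proof. by rewrite shuffles_cons big_cat !big_map. Qed.

(** Left combs grow at their last letter, next to the root, so the comparison of
    shuffles with brackets needs the recursion from the right end. *)
Lemma sum_shuffles_rcons (V : nmodType) (g : seq T -> V) u a v b :
  \sum_(w <- shuffles (rcons u a) (rcons v b)) g w =
  \sum_(w <- shuffles u (rcons v b)) g (rcons w a)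
    + \sum_(w <- shuffles (rcons u a) v) g (rcons w b).
Proof.
elim: u v g => [|c u IHu] v g; elim: v g => [|d v IHv] g /=.
- by rewrite sum_shuffles_cons !big_seq1 addrC.
- rewrite !sum_shuffles_cons IHv /= shuffles0l !big_seq1.
  by rewrite !rcons_cons addrCA.
- rewrite !sum_shuffles_cons (IHu [::]) /= !shuffles0r !big_seq1.
  by rewrite !rcons_cons addrAC.
- rewrite !sum_shuffles_cons -rcons_cons IHu IHv /=.
  by rewrite addrACA.
Qed.
End Shuffles.
#[local] Arguments shuffles : simpl never.

Lemma shuffles_map (T U : Type) (f : T -> U) (u v : seq T) :
  shuffles (map f u) (map f v) = map (map f) (shuffles u v).
Proof.
elim: u v => [|a u IHu] v //; elim: v => [|b v IHv] //.
rewrite map_cons map_cons shuffles_cons -!map_cons IHu IHv.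
by rewrite shuffles_cons map_cat -!map_comp.
Qed.

Lemma all_shuffles (T : eqType) (P : pred T) (u v w : seq T) :
  w \in shuffles u v -> all P u -> all P v -> all P w.
Proof.
elim: u v w => [|a u IHu] v w; first by rewrite inE => /eqP ->.
elim: v w => [|b v IHv] w; first by rewrite shuffles0r inE => /eqP ->.
rewrite shuffles_cons mem_cat => /orP[] /mapP[w' w'P ->] /=.
- by case/andP=> -> Pu Pv; exact: IHu w'P _ _.
- by move=> Pu /andP[-> Pv]; exact: IHv.
Qed.

Lemma size_shuffles (T : eqType) (u v w : seq T) :
  w \in shuffles u v -> size w = (size u + size v)%N.
Proof.
elim: u v w => [|a u IHu] v w; first by rewrite inE => /eqP ->.
elim: v w => [|b v IHv] w; first by rewrite shuffles0r inE addn0 => /eqP ->.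
rewrite shuffles_cons mem_cat => /orP[] /mapP[w' w'P ->] /=.
- by rewrite (IHu _ _ w'P).
- by rewrite (IHv _ w'P) addnS.
Qed.

Section ShuffleVanishing.
Variables (T : eqType) (V : zmodType) (y : T).

(** In a shuffle of [u] and [y :: v] only letters of [u] precede that [y], and
    they form a prefix of [u]; it is all of [u] for the single shuffle
    [u ++ y :: v]. *)
Lemma shuffle_peel (P : pred T) (g : seq T -> V) u v :
  all P u -> all P v ->
  (forall p w, all P p -> all P w -> (size p + size w = size u + size v)%N ->
     (size p < size u)%N -> g (p ++ y :: w) = 0) ->
  \sum_(w <- shuffles u (y :: v)) g w = g (u ++ y :: v).
Proof.
elim: u g => [|c u IHu] g /=; first by rewrite big_seq1.
move=> /andP[Pc Pu] Pv g0; rewrite sum_shuffles_cons [X in _ + X]big_seq.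
rewrite [X in _ + X]big1 => [|w wP]; last first.
  apply: (g0 [::]) => //; last exact: size_shuffles wP.
  by apply: all_shuffles wP _ Pv => /=; rewrite Pc.
rewrite addr0 (IHu (g \o cons c)) //= => p w Pp Pw eqpu ltpu.
by apply: (g0 (c :: p)) => //=; rewrite ?Pc // !addSn eqpu.
Qed.

(** By duality, a functional that kills all proper shuffles is the coefficient
    function of a Lie element, and a Lie element is determined by the
    coefficients of the words that begin with one given letter [y]: in the
    shuffle relation of [u] with [y :: v], every word but [u ++ y :: v] has
    fewer letters in front of [y]. *)
Lemma shuffle_vanishing (P Q : pred T) (g : seq T -> V) u v :
  subpred P Q -> Q y ->
  (forall u v, u != [::] -> v != [::] -> all Q u -> all Q v ->
     \sum_(w <- shuffles u v) g w = 0) ->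
  (forall w, all P w -> size w = (size u + size v)%N -> g (y :: w) = 0) ->
  all P u -> all P v -> g (u ++ y :: v) = 0.
Proof.
move=> PQ Qy shg; have [n] := ubnP (size u).
elim: n => // n IHn in u v * => /ltnSE leun g0 Pu Pv.
case: (eqVneq u [::]) => [u0 | u0]; first by rewrite u0 g0 // u0.
rewrite -(@shuffle_peel P) //; last first.
  move=> p w Pp Pw eqpu ltpu; apply: IHn => //; first exact: leq_trans leun.
  by rewrite eqpu.
by apply: shg => //=; rewrite ?Qy; apply: sub_all PQ _ _.
Qed.
End ShuffleVanishing.

(** * Coefficients of AC-polynomials on planar trees *)
Section Coeff.
Variables (k : fieldType) (X : eqType).
Local Notation tree := (ac_mono X).
Local Notation deg := ac_mono_deg.
Implicit Types (x y : X) (t p q r : tree) (s : seq tree).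

HB.instance Definition _ := gen_eqMixin tree.

Lemma leaf_ex t : exists x, ac_mono_deg x t != 0%N.
Proof.
elim: t => [x|p [x px] q _]; exists x; first by rewrite /= eqxx.
by rewrite /= addn_eq0 (negbTE px).
Qed.

Definition delta x : coef k X := fun t =>
  if t is ACMvar y then (x == y)%:R else 0.

Definition coeff : freeAC k X -> coef k X := ac_lift delta.
HB.instance Definition _ := GRing.Linear.on coeff.

Lemma coeff_bracket F G : coeff (bracket F G) = bracket (coeff F) (coeff G).
Proof. exact: ac_lift_br. Qed.

Lemma coeff_br F G p q : coeff (bracket F G) (ACMbr p q) =
  coeff F p * coeff G q - coeff F q * coeff G p.
Proof. by rewrite coeff_bracket. Qed.

Lemma coeff_var x : coeff (ac_var k x) = delta x.
Proof. exact: ac_lift_var. Qed.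

Lemma coeffD F G t : coeff (F + G) t = coeff F t + coeff G t.
Proof. by rewrite linearD. Qed.

Lemma coeffZ (a : k) F t : coeff (a *: F) t = a * coeff F t.
Proof. by rewrite linearZ. Qed.

Lemma coeff_sum I (r : seq I) (c : I -> k) (F : I -> freeAC k X) t :
  coeff (\sum_(i <- r) c i *: F i) t = \sum_(i <- r) c i * coeff (F i) t.
Proof.
rewrite linear_sum fct_sumE; apply: eq_bigr => i _.
by rewrite linearZ.
Qed.

Lemma coeff_support w t x :
  coeff (ac_mono_val k w) t != 0 -> deg x t = deg x w.
Proof.
elim: w t => [y|v IHv w IHw] [z|p q] /=; rewrite ?coeff_var /= ?eqxx //.
- by case: (eqVneq y z) => [->|]; rewrite ?eqxx.
- by rewrite coeff_bracket eqxx.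
- rewrite coeff_br => neq0; apply/eqP; apply: contraNT neq0 => neq.
  have prod0 p' q' : (deg x p' + deg x q' != deg x v + deg x w)%N ->
      coeff (ac_mono_val k v) p' * coeff (ac_mono_val k w) q' = 0.
    apply: contraNeq; rewrite mulf_eq0 negb_or => /andP[/IHv -> /IHw ->].
    exact: eqxx.
  by rewrite !prod0 ?subr0 // addnC.
Qed.

(** Equality up to the sign [(-1) ^+ e] as coordinates on AC(X): the trees [t]
    and [t'] differ by flips of their nodes. *)
Definition flip_sim (e : bool) t t' :=
  forall F, coeff F t = (-1) ^+ e * coeff F t'.

Lemma flip_sim_refl t : flip_sim false t t.
Proof. by move=> F; rewrite mul1r. Qed.

Lemma flip_sim_trans e1 e2 t1 t2 t3 :
  flip_sim e1 t1 t2 -> flip_sim e2 t2 t3 -> flip_sim (e1 (+) e2) t1 t3.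
Proof. by move=> s12 s23 F; rewrite s12 s23 mulrA signr_addb. Qed.

(** Linear identities between coefficients pass from generators to all of AC(X)
    along the operations. *)
Lemma coeff_ind (P : freeAC k X -> Prop) :
  (forall x, P (ac_var k x)) -> P 0 ->
  (forall F G, P F -> P G -> P (F + G)) -> (forall a F, P F -> P (a *: F)) ->
  (forall F G, P F -> P G -> P (bracket F G)) -> forall F, P F.
Proof.
move=> Pvar P0 PD PZ Pbr; elim/ac_ind; elim=> // [s Ps t Pt|a s Ps|s Ps t Pt].
- by rewrite ac_piD; apply: PD.
- by rewrite ac_piZ; apply: PZ.
- by rewrite ac_pi_br; apply: Pbr.
Qed.

Lemma flip_sim_root p q : flip_sim true (ACMbr p q) (ACMbr q p).
Proof.
move=> F; elim/coeff_ind: F => [x||F G IHF IHG|a F IHF|F G _ _].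
- by rewrite coeff_var mulr0.
- by rewrite linear0 mulr0.
- by rewrite !coeffD IHF IHG mulrDr.
- by rewrite !coeffZ IHF mulrCA.
- by rewrite !coeff_br mulN1r opprB.
Qed.

Lemma flip_sim_brl e p p' q :
  flip_sim e p p' -> flip_sim e (ACMbr p q) (ACMbr p' q).
Proof.
move=> pp' F; elim/coeff_ind: F => [x||F G IHF IHG|a F IHF|F G _ _].
- by rewrite coeff_var mulr0.
- by rewrite linear0 mulr0.
- by rewrite !coeffD IHF IHG mulrDr.
- by rewrite !coeffZ IHF mulrCA.
- by rewrite !coeff_br !pp' mulrBr !mulrA [coeff F q * _]mulrC.
Qed.

Definition is_leaf t := if t is ACMvar _ then true else false.

(** The left normed bracket {...{{t, s_1}, s_2}, ..., s_d}: the word [s] in the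
    tensor algebra acting on [t] by right brackets. *)
Definition graft t s : tree := foldl (@ACMbr X) t s.

Lemma graft_rcons t s r : graft t (rcons s r) = ACMbr (graft t s) r.
Proof. by rewrite /graft -cats1 foldl_cat. Qed.

Lemma deg_graft x t s : deg x (graft t s) = (deg x t + sumn (map (deg x) s))%N.
Proof.
elim/last_ind: s => [|s r IHs]; first by rewrite addn0.
by rewrite graft_rcons /= IHs map_rcons sumn_rcons addnA.
Qed.

Lemma flip_sim_graft e t t' s :
  flip_sim e t t' -> flip_sim e (graft t s) (graft t' s).
Proof. by elim: s t t' => //= r s IHs t t' /(flip_sim_brl r)/IHs. Qed.

(** Flipping the nodes on the path from the root to a leaf [x] puts that path on
    the left edge of the tree. *)
Lemma flip_sim_spine x t : deg x t != 0%N ->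
  exists e, exists s, flip_sim e t (graft (ACMvar x) s) /\ nilp s = is_leaf t.
Proof.
elim: t => [y|p IHp q IHq] /=.
  case: (eqVneq x y) => //= <- _; exists false, [::].
  by split=> //; exact: flip_sim_refl.
have [/eqP p0|px0 _] := boolP (deg x p == 0)%N.
  rewrite p0 => /IHq[e [s [qs _]]]; exists (true (+) e), (rcons s p).
  split; last by case: {qs} s.
  apply: flip_sim_trans (flip_sim_root _ _) _.
  by rewrite graft_rcons; apply: flip_sim_brl.
have [e [s [ps _]]] := IHp px0; exists e, (rcons s q).
split; last by case: {ps} s.
by rewrite graft_rcons; apply: flip_sim_brl.
Qed.

Lemma flip_sim_graft_swap t r s :
  flip_sim true (graft t (r :: s)) (graft r (t :: s)).
Proof. exact/(flip_sim_graft s)/flip_sim_root. Qed.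

(** * The square substitution x := x x *)

Definition free_of x : pred tree := fun t => deg x t == 0%N.

Definition trunc_deg1 (f : coef k X) : trunc k X := (0, f, 0).

Lemma sym_der0 f : sym_der f 0 = 0 :> (tree -> coef k X).
Proof.
have z (s t : tree) : (0 : tree -> coef k X) s t = 0 by [].
apply/funext=> s; apply/funext=> t; rewrite z /sym_der.
by case: s t => [y|p q] [y'|p' q'] /=; rewrite ?(z, mulr0, subr0, addr0).
Qed.

Lemma trunc_deg1_br f g :
  bracket (trunc_deg1 f) (trunc_deg1 g) = trunc_deg1 (bracket f g).
Proof. by congr (_, _, _); rewrite /= !sym_der0 subr0. Qed.

Fact trunc_deg1_is_linear : linear trunc_deg1.
Proof.
move=> a f g; congr (_, _, _); rewrite /=; first by rewrite scaler0 addr0.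
by rewrite scaler0 addr0.
Qed.
HB.instance Definition _ :=
  GRing.isLinear.Build k (coef k X) (trunc k X) *:%R trunc_deg1
    trunc_deg1_is_linear.

Lemma ac_lift_trunc_deg1 F :
  ac_lift (fun y => trunc_deg1 (delta y)) F = trunc_deg1 (coeff F).
Proof.
elim/coeff_ind: F => [x||F G IHF IHG|a F IHF|F G IHF IHG].
- by rewrite ac_lift_var coeff_var.
- by rewrite !linear0.
- by rewrite !linearD /= IHF IHG.
- by rewrite !linearZ /= IHF.
- by rewrite ac_lift_br IHF IHG trunc_deg1_br coeff_bracket.
Qed.

(** The derivation identity is tested on y = z = x: up to a factor 2 this
    determines T(y z), because the unshuffle coproduct is cocommutative. *)
Definition square_at x : X -> trunc k X := fun y =>
  if y == x then trunc_deg1 (delta x) * trunc_deg1 (delta x)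
  else trunc_deg1 (delta y).

Lemma trunc_deg1_mul f g : trunc_deg1 f * trunc_deg1 g = (0, 0, sym_mul f g).
Proof.
congr (_, _, _); first exact: mulr0; last by rewrite !scale0r add0r add0r.
by rewrite !scale0r addr0.
Qed.

Lemma square_free x w : free_of x w ->
  ac_lift (square_at x) (ac_mono_val k w) =
  trunc_deg1 (coeff (ac_mono_val k w)).
Proof.
rewrite /free_of; elim: w => [y|v IHv w IHw] /=.
  by rewrite ac_lift_var coeff_var /square_at eq_sym; case: (eqVneq y x).
rewrite addn_eq0 => /andP[/IHv vE /IHw wE].
by rewrite ac_lift_br vE wE trunc_deg1_br coeff_bracket.
Qed.

(** An element linear in [x] is T(x) for an operator T in the tensor algebra on
    the trees free of [x]; then [f] holds the coefficients of T, and [Q] is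
    required to hold those of the unshuffle coproduct of T applied to x * x,
    which is twice the tensor of x with itself. The last clause says that [Q]
    lives on pairs of trees that both contain [x]. *)
Definition unshuffles x (f : coef k X) (Q : tree -> coef k X) :=
  (forall u v, all (free_of x) u -> all (free_of x) v ->
     Q (graft (ACMvar x) u) (graft (ACMvar x) v) =
     (\sum_(w <- shuffles u v) f (graft (ACMvar x) w)) *+ 2) /\
  (forall a t, free_of x a -> Q a t = 0 /\ Q t a = 0).

Lemma unshuffles_sym_mul x :
  unshuffles x (delta x) (sym_mul (delta x) (delta x)).
Proof.
have dg u : u != [::] -> delta x (graft (ACMvar x) u) = 0.
  by elim/last_ind: u => // u r _ _; rewrite graft_rcons.
have df a : free_of x a -> delta x a = 0.
  by case: a => //= y; rewrite /free_of /=; case: (eqVneq x y).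
split=> [u v _ _|a t /df xa]; last first.
  by rewrite /sym_mul !xa !(mul0r, mulr0) addr0.
rewrite /sym_mul.
case: (eqVneq u [::]) => [->|u0]; case: (eqVneq v [::]) => [->|v0].
- by rewrite big_seq1 /= eqxx mulr1.
- by rewrite shuffles0l big_seq1 (dg v) // mulr0 mul0r addr0 mul0rn.
- by rewrite shuffles0r big_seq1 (dg u) // mulr0 mul0r addr0 mul0rn.
- rewrite (dg u) // mul0r mulr0 addr0 big_seq big1 ?mul0rn // => w wP.
  by rewrite dg // -size_eq0 (size_shuffles wP) addn_eq0 size_eq0 (negbTE u0).
Qed.

Lemma unshuffles0 x : unshuffles x 0 0.
Proof. by split=> // u v _ _; rewrite big1 // mul0rn. Qed.

Lemma unshuffles_linear x (a : k) f g Q R :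
  unshuffles x f Q -> unshuffles x g R ->
  unshuffles x (a *: f + g) (a *: Q + R).
Proof.
case=> Qsh Q0 [Rsh R0]; split=> [u v xu xv|b t xb].
- rewrite !(addrfctE, scalrfctE) Qsh // Rsh //.
  by rewrite big_split -scaler_sumr mulrnDl scalerMnr.
- have [Qbt Qtb] := Q0 b t xb; have [Rbt Rtb] := R0 b t xb.
  by rewrite !(addrfctE, scalrfctE) Qbt Qtb Rbt Rtb !scaler0 !addr0.
Qed.

Lemma unshufflesN x f Q : unshuffles x f Q -> unshuffles x (- f) (- Q).
Proof.
by move/(unshuffles_linear (-1))/(_ (unshuffles0 x)); rewrite !scaleN1r !addr0.
Qed.

(** The bracket with an element free of [x] appends a letter to T. Being a
    derivation, it appends that letter to either tensor factor, which is the
    recursion of shuffles from the right end. *)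
Lemma unshuffles_bracket x f g Q :
  unshuffles x f Q ->
  (forall t, ~~ free_of x t -> g t = 0) ->
  unshuffles x (bracket f g) (- sym_der g Q).
Proof.
move=> [Qsh Q0] g0.
have gx u : g (graft (ACMvar x) u) = 0.
  by apply: g0; rewrite /free_of deg_graft /= eqxx.
have der0 (h : coef k X) : coef_br g h (graft (ACMvar x) [::]) = 0 by [].
have derS (h : coef k X) u a : coef_br g h (graft (ACMvar x) (rcons u a)) =
    - (g a * h (graft (ACMvar x) u)).
  by rewrite graft_rcons /= gx mul0r sub0r.
have brS u a : bracket f g (graft (ACMvar x) (rcons u a)) =
    f (graft (ACMvar x) u) * g a.
  by rewrite graft_rcons /bracket /= gx mulr0 subr0.
have der_eq0 (h : coef k X) t : (forall p, free_of x p -> h p = 0) ->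
    free_of x t -> coef_br g h t = 0.
  move=> h0; case: t => // p q; rewrite /free_of /= addn_eq0 => /andP[xp xq].
  by rewrite !h0 // !mulr0 subrr.
have der_zero (h : coef k X) t : (forall p, h p = 0) -> coef_br g h t = 0.
  by move=> h0; case: t => // p q /=; rewrite !h0 !mulr0 subrr.
split=> [u v|a t xa]; rewrite !opprfctE /sym_der.
- case/lastP: u => [|u a]; case/lastP: v => [|v b]; rewrite ?all_rcons.
  + by rewrite !der0 addr0 oppr0 big_seq1 mul0rn.
  + move=> _ /andP[xb xv]; rewrite der0 derS (Qsh [::]) //.
    by rewrite !shuffles0l !big_seq1 brS add0r opprK mulrC mulrnAl.
  + move=> /andP[xa xu] _; rewrite der0 derS (Qsh u [::]) //.
    by rewrite !shuffles0r !big_seq1 brS addr0 opprK mulrC mulrnAl.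
  + move=> /andP[xa xu] /andP[xb xv]; rewrite !derS !Qsh ?all_rcons ?xa ?xb //.
    rewrite sum_shuffles_rcons -opprD opprK mulrnDl.
    rewrite !mulrnAr !mulr_sumr; congr (_ *+ _ + _ *+ _).
      by apply: eq_bigr => w _; rewrite brS mulrC.
    by apply: eq_bigr => w _; rewrite brS mulrC.
- have -> : coef_br g (Q a) t = 0.
    by apply: der_zero => p; have [] := Q0 a p xa.
  have -> : coef_br g (Q^~ a) t = 0.
    by apply: der_zero => p; have [] := Q0 a p xa.
  have -> : coef_br g (Q t) a = 0.
    by apply: der_eq0 => // p xp; have [] := Q0 p t xp.
  have -> : coef_br g (Q^~ t) a = 0.
    by apply: der_eq0 => // p xp; have [] := Q0 p t xp.
  by rewrite addr0 oppr0.
Qed.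

(** The substitution x := x x turns T(x) into T(x x), and the Leibniz rule
    distributes the letters of T over the two factors in all ways. *)
Lemma ac_lift_square x w : deg x w = 1%N -> exists Q,
  unshuffles x (coeff (ac_mono_val k w)) Q /\
  ac_lift (square_at x) (ac_mono_val k w) = (0, 0, Q).
Proof.
have brE p q Q : deg x p = 1%N -> free_of x q ->
    unshuffles x (coeff (ac_mono_val k p)) Q ->
    ac_lift (square_at x) (ac_mono_val k p) = (0, 0, Q) ->
  exists Q, unshuffles x (coeff (ac_mono_val k (ACMbr p q))) Q /\
    ac_lift (square_at x) (ac_mono_val k (ACMbr p q)) = (0, 0, Q).
  move=> p1 q0 Qsh pE; exists (- sym_der (coeff (ac_mono_val k q)) Q); split.
    rewrite [coeff _]coeff_bracket; apply: unshuffles_bracket => // t xt.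
    by apply: contraNeq xt => /(@coeff_support _ _ x); rewrite /free_of => ->.
  rewrite ac_lift_br pE (square_free q0); congr (_, _, _) => /=.
    by apply/funext=> -[y|r t] //=; rewrite !mul0r subrr.
  by rewrite sym_der0 sub0r.
elim: w => [y|v IHv w IHw].
  rewrite /= ; case: (eqVneq x y) => // <- _.
  exists (sym_mul (delta x) (delta x)); rewrite coeff_var.
  split; first exact: unshuffles_sym_mul.
  by rewrite ac_lift_var /square_at eqxx trunc_deg1_mul.
rewrite [deg _ _]/=; case dv: (deg x v) => [|[|?]] //; rewrite ?add0n => dw.
  have [Q [Qsh wE]] := IHw dw.
  have v0 : free_of x v by rewrite /free_of dv.
  have [Q' [Q'sh brE']] := brE w v Q dw v0 Qsh wE.
  exists (- Q'); rewrite /= bracketC !linearN; split; first exact: unshufflesN.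
  by have /= -> := brE'; congr (_, _, _); rewrite /= oppr0.
have [Q [Qsh vE]] := IHv dv.
by apply: brE Qsh vE => //; move/eqP: dw; rewrite addSn eqSS.
Qed.
End Coeff.

(** * Derivations and shuffle relations *)
Section Derivation.
Variables (k : fieldType) (X : eqType).
Local Notation tree := (ac_mono X).
Local Notation deg := ac_mono_deg.
Implicit Types (x y : X) (t p q r : tree) (s u v : seq tree).
Implicit Types (F G Psi : freeAC k X).

Lemma gp_lift_subst x (A : gpAlgType k) (h : split_var x -> A) w
    (F : freeGP k X) :
  gp_lift h (gp_subst w F) =
  gp_lift (fun z : X => if insub z is Some v then h (inl v : split_var x)
                        else gp_lift h w) F.
Proof.
elim/gp_ind: F; rewrite /gp_subst.
elim=> [u|||s IHs t IHt|a s IHs|s IHs t IHt|s IHs t IHt].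
- by rewrite !gp_lift_var; case: insubP => [v _ _|_] //; rewrite gp_lift_var.
- by rewrite !linear0.
- by rewrite -[gp_pi _]/(1 : freeGP k X) !rmorph1.
- by rewrite gp_piD !linearD /= IHs IHt.
- by rewrite gp_piZ !linearZ /= IHs.
- by rewrite gp_piM !rmorphM /= IHs IHt.
- by rewrite gp_pi_br !gp_lift_br IHs IHt.
Qed.

(** The derivation identity holds in the free GP-algebra, hence under every
    evaluation in a GP-algebra. *)
Lemma derivation_lift x (F : freeGP k X) (A : gpAlgType k) (f : X -> A)
    (p q : A) :
  derivation_wrt x F ->
  let ev w := gp_lift (fun z : X => if z == x then w else f z) F in
  ev (p * q) = p * ev q + q * ev p.
Proof.
case=> _ dF; pose h (b : split_var x) : A :=
  match b with inl z => f (val z) | inr c => if c then q else p end.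
have subst w : gp_lift h (gp_subst w F) =
    gp_lift (fun z : X => if z == x then gp_lift h w else f z) F.
  rewrite gp_lift_subst; congr (gp_lift _ F); apply/funext=> u.
  by case: insubP => [v ux /= ->|/negbNE ->//]; rewrite (negbTE ux).
have hyz : gp_lift h (gp_y k x * gp_z k x) = p * q.
  by rewrite rmorphM /= !gp_lift_var.
have := congr1 (gp_lift h) dF.
by rewrite rmorphD !rmorphM /= !subst hyz !gp_lift_var.
Qed.

Lemma gp_lift_ac_to_gp (A : gpAlgType k) (f : X -> A) F :
  gp_lift f (ac_to_gp F) = ac_lift f F.
Proof.
rewrite /ac_to_gp; elim/coeff_ind: F => [x||F G IHF IHG|a F IHF|F G IHF IHG].
- by rewrite !ac_lift_var gp_lift_var.
- by rewrite !linear0.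
- by rewrite !linearD /= IHF IHG.
- by rewrite !linearZ /= IHF.
- by rewrite !ac_lift_br gp_lift_br IHF IHG.
Qed.

Hypothesis two_neq0 : 2%:R != 0 :> k.

Lemma polylinear_square x Psi : polylinear Psi -> exists Q,
  unshuffles x (coeff Psi) Q /\ ac_lift (square_at k x) Psi = (0, 0, Q).
Proof.
case=> r [c [w [wdeg ->]]]; elim/big_rec: _ => [|i F _ [Q [Qsh FE]]].
  exists 0; rewrite !linear0; split=> //; exact: unshuffles0.
have [R [Rsh wE]] := ac_lift_square k (wdeg i x).
exists (c i *: R + Q); rewrite !linearP /= wE FE; split.
  exact: unshuffles_linear.
by congr (_, _, _); rewrite /= scaler0 addr0.
Qed.

Lemma jacobian_square x Psi : jacobian Psi -> exists2 Q,
  unshuffles x (coeff Psi) Q &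
  forall t1 t2, Q t1 t2 = sym_mul (delta k x) (coeff Psi) t1 t2 *+ 2.
Proof.
case=> polyPsi derPsi; have [Q [Qsh PsiE]] := polylinear_square x polyPsi.
exists Q => // t1 t2.
have /= := derivation_lift (fun z : X => trunc_deg1 (delta k z))
  (trunc_deg1 (delta k x)) (trunc_deg1 (delta k x)) (derPsi x).
rewrite !gp_lift_ac_to_gp -/(square_at k x) PsiE.
have -> : (fun z : X => if z == x then trunc_deg1 (delta k x)
                        else trunc_deg1 (delta k z)) =
          (fun z : X => trunc_deg1 (delta k z)).
  by apply/funext=> u; case: eqVneq => // ->.
rewrite ac_lift_trunc_deg1 trunc_deg1_mul.
by move=> /(congr1 (fun a => a.2 t1 t2))/= ->.
Qed.

(** Friedrichs' criterion in its dual form: the derivation identity says that T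
    is primitive for the unshuffle coproduct, so the pairs of nonempty words
    have coefficient 0 in the coproduct of T. *)
Lemma jacobian_shuffle x Psi u v : jacobian Psi -> u != [::] -> v != [::] ->
  all (free_of x) u -> all (free_of x) v ->
  \sum_(w <- shuffles u v) coeff Psi (graft (ACMvar x) w) = 0.
Proof.
move=> jacPsi u0 v0 xu xv; have [Q [Qsh _] QE] := jacobian_square x jacPsi.
have dg s : s != [::] -> delta k x (graft (ACMvar x) s) = 0.
  by elim/last_ind: s => // s r _ _; rewrite graft_rcons.
have := Qsh u v xu xv.
rewrite QE /sym_mul !dg // !mul0r addr0 mul0rn => /esym/eqP.
by rewrite -mulr_natr mulf_eq0 (negbTE two_neq0) orbF => /eqP.
Qed.

(** On the pair of empty words the coproduct gives the constant term of T once
    and a primitive element gives it twice; this excludes n = 1. *)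
Lemma jacobian_var x Psi : jacobian Psi -> coeff Psi (ACMvar x) = 0.
Proof.
move=> jacPsi; have [Q [Qsh _] QE] := jacobian_square x jacPsi.
have := Qsh [::] [::] isT isT; rewrite QE /sym_mul /= eqxx mul1r big_seq1 /=.
move/eqP; rewrite !mulr2n -subr_eq0 addrK -mulr2n -mulr_natr mulf_eq0.
by rewrite (negbTE two_neq0) orbF => /eqP.
Qed.

Lemma polylinear_support x Psi t :
  polylinear Psi -> coeff Psi t != 0 -> deg x t = 1%N.
Proof.
case=> r [c [w [wdeg ->]]]; rewrite coeff_sum => neq0; apply/eqP.
apply: contraNT neq0 => dt; rewrite big1 // => i _.
suff -> : coeff (ac_mono_val k (w i)) t = 0 by rewrite mulr0.
by apply: contraNeq dt => /(@coeff_support _ _ _ _ x) ->; rewrite wdeg.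
Qed.
End Derivation.

(** * Shuffle sums of alternating functions *)
Section Alternating.
Variables (k : fieldType) (T : eqType) (base : seq T) (h : seq T -> k).
Hypothesis alt : forall u p q w, perm_eq (u ++ p :: q :: w) base ->
  h (u ++ p :: q :: w) = - h (u ++ q :: p :: w).

(** Moving [a] one place to the right changes the sign, so the terms cancel in
    pairs. *)
Lemma alternating_insert1 u a v : perm_eq (u ++ a :: v) base ->
  \sum_(w <- shuffles [:: a] v) h (u ++ w) =
  (~~ odd (size v))%:R * h (u ++ a :: v).
Proof.
elim: v u => [|c v IHv] u perm_h; first by rewrite big_seq1 mul1r.
have perm_ac : perm_eq (rcons u c ++ a :: v) base.
  rewrite -(permPr perm_h) cat_rcons perm_cat2l.
  exact/permPl/(perm_catCA [:: c] [:: a]).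
rewrite sum_shuffles_cons shuffles0l big_seq1.
under eq_bigr do rewrite -cat_rcons.
have hca : h (u ++ [:: c, a & v]) = - h (u ++ [:: a, c & v]).
  by apply: alt; rewrite -cat_rcons.
rewrite IHv // cat_rcons hca /= negbK.
by case: (odd _); rewrite ?mul1r ?mul0r ?addr0 ?subrr.
Qed.

(** The factor is the Gaussian binomial coefficient of [size v + 2] over 2 at
    q = -1. It is positive, whereas the sum over the insertions of one letter
    can vanish: hence the use of two letters. *)
Lemma alternating_insert2 u a b v : perm_eq (u ++ [:: a, b & v]) base ->
  \sum_(w <- shuffles [:: a; b] v) h (u ++ w) =
  (size v)./2.+1%:R * h (u ++ [:: a, b & v]).
Proof.
elim: v u => [|c v IHv] u perm_h; first by rewrite big_seq1 mul1r.
have perm_cab : perm_eq (rcons u c ++ [:: a, b & v]) base.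
  rewrite -(permPr perm_h) cat_rcons perm_cat2l.
  exact/permPl/(perm_catCA [:: c] [:: a; b]).
have perm_acb : perm_eq (rcons u a ++ [:: c, b & v]) base.
  rewrite -(permPr perm_h) cat_rcons perm_cat2l perm_cons.
  exact/permPl/(perm_catCA [:: c] [:: b]).
rewrite sum_shuffles_cons.
under eq_bigr do rewrite -cat_rcons.
under [X in _ + X]eq_bigr do rewrite -cat_rcons.
have hcab : h (u ++ [:: c, a, b & v]) = h (u ++ [:: a, b, c & v]).
  rewrite (@alt u c a); last by rewrite -cat_rcons.
  by rewrite -[in LHS]cat_rcons (@alt (rcons u a) c b) // opprK cat_rcons.
have insa := @alternating_insert1 (rcons u a) b (c :: v).
rewrite IHv // insa ?cat_rcons // hcab -mulrDl -natrD.
by congr (_%:R * _); rewrite /= negbK uphalf_half addnS.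
Qed.

End Alternating.

(** * Combs on which a Jacobian AC-polynomial has a coefficient *)
Section Combs.
Variables (k : fieldType) (X : finType).
Local Notation tree := (ac_mono X).
Local Notation deg := ac_mono_deg.
Implicit Types (x y : X) (t p q r : tree) (s : seq tree) (l u v : seq X).

Definition weight t := (\sum_x deg x t)%N.

Lemma weight_br p q : weight (ACMbr p q) = (weight p + weight q)%N.
Proof. exact: big_split. Qed.

Lemma weight_var x : weight (ACMvar x) = 1%N.
Proof. by rewrite /weight (bigD1 x) //= eqxx big1 // => y /negbTE ->. Qed.

Lemma weight_gt0 t : (0 < weight t)%N.
Proof.
by elim: t => [x|p IHp q _]; rewrite ?weight_var // weight_br ltn_addr.
Qed.

Lemma weight_graft x s : (size s < weight (graft (ACMvar x) s))%N.
Proof.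
elim/last_ind: s => [|s r IHs]; first by rewrite weight_var.
rewrite graft_rcons weight_br size_rcons.
by have := weight_gt0 r; lia.
Qed.

Lemma weight_eq1 t : weight t = 1%N -> exists x, t = ACMvar x.
Proof.
case: t => [x _|p q]; first by exists x.
by rewrite weight_br; have := weight_gt0 p; have := weight_gt0 q; lia.
Qed.

Lemma sumn_free x s :
  (sumn (map (deg x) s) == 0)%N = all (free_of x) s.
Proof. by elim: s => //= r s <-; rewrite addn_eq0. Qed.

Definition left_comb x l : tree := graft (ACMvar x) (map (@ACMvar X) l).

Lemma deg_comb y x l : deg y (left_comb x l) = count_mem y (x :: l).
Proof.
rewrite deg_graft /= eq_sym; congr (_ + _)%N.
by elim: l => //= z l ->; rewrite eq_sym.
Qed.

Lemma flip_sim_comb x y l :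
  flip_sim k true (left_comb x (y :: l)) (left_comb y (x :: l)).
Proof. exact: flip_sim_graft_swap. Qed.

Lemma all_free x u : x \notin u -> all (free_of x) (map (@ACMvar X) u).
Proof.
move=> xu; apply/allP=> _ /mapP[y yu ->]; rewrite /free_of /= eqb0.
by apply: contraNneq xu => ->.
Qed.

Lemma coeff_weight (F : freeAC k X) t :
  polylinear F -> coeff F t != 0 -> weight t = #|X|.
Proof.
move=> polyF Ft; rewrite -sum1_card; apply: eq_bigr => x _.
exact: polylinear_support polyF Ft.
Qed.

Lemma comb_perm (F : freeAC k X) x l :
  polylinear F -> coeff F (left_comb x l) != 0 -> perm_eq (x :: l) (enum X).
Proof.
move=> polyF neq0; apply/allP=> y _; apply/eqP; rewrite -deg_comb.
rewrite (polylinear_support y polyF neq0).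
by rewrite (count_uniq_mem _ (enum_uniq _)) mem_enum.
Qed.

Variable Psi : freeAC k X.
Hypotheses (two_neq0 : 2%:R != 0 :> k) (jacPsi : jacobian Psi).

(** Among the expansions [graft (ACMvar x) s] with a nonzero coefficient, one
    with [s] of maximal length has only leaves in [s]. Otherwise [s] has an
    entry [a] that is not a leaf; by [shuffle_vanishing] the coefficient would
    be nonzero for some word that starts with [a], and such a tree has a longer
    path, through [a]. *)
Lemma coeff_comb_neq0 t : coeff Psi t != 0 ->
  exists x l, coeff Psi (left_comb x l) != 0.
Proof.
move=> Psit; pose nz m :=
  `[< exists x s, size s = m /\ coeff Psi (graft (ACMvar x) s) != 0 >].
have nz_graft r x : coeff Psi r != 0 -> deg x r != 0%N ->
    exists s, coeff Psi (graft (ACMvar x) s) != 0 /\ nilp s = is_leaf r.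
  move=> Psir /(flip_sim_spine k)[e [s [rs leaf_r]]]; exists s; split=> //.
  by apply: contraNneq Psir => s0; rewrite rs s0 mulr0.
have ex_nz : exists m, nz m.
  have [x xt] := leaf_ex t; have [s [nzs _]] := nz_graft t x Psit xt.
  by exists (size s); apply/asboolP; exists x, s.
have nz_bound m : nz m -> (m <= #|X|)%N.
  move=> /asboolP[x [s [<- /(coeff_weight jacPsi.1) <-]]].
  exact/ltnW/weight_graft.
have [m /asboolP[x [s [sm nzs]]] maxm] := ex_maxnP ex_nz nz_bound.
have max y s' : (m < size s')%N -> coeff Psi (graft (ACMvar y) s') = 0.
  move=> lts; apply: contraTeq lts => nz'; rewrite -leqNgt; apply: maxm.
  by apply/asboolP; exists y, s'.
suff /allP leaves : all (@is_leaf X) s.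
  exists x, (map (fun r => if r is ACMvar y then y else x) s).
  rewrite /left_comb -map_comp (eq_in_map _ id _).1 ?map_id // => r /leaves.
  by case: r.
have xs : all (free_of x) s.
  have := polylinear_support x jacPsi.1 nzs.
  by rewrite deg_graft /= eqxx => -[/eqP]; rewrite sumn_free.
apply/allP=> a sa; apply: contraNT nzs => Na; apply/eqP.
move: xs sm; case/splitPr: sa => u v; rewrite all_cat /= => /and3P[xu xa xv] sm.
pose g w := coeff Psi (graft (ACMvar x) w).
apply: (shuffle_vanishing (P := free_of x) (Q := free_of x) (g := g)) => //.
  by move=> *; apply: jacobian_shuffle.
move=> w _ sw; apply: contraTeq isT => gaw.
have [z za] := leaf_ex a; have [e [s' [as' ls']]] := flip_sim_spine k za.
have s'0 : (0 < size s')%N by move: ls'; rewrite (negbTE Na); case: (s').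
(* Seen from the leaf [z] of [a], the path also passes [x] and all of [w]. *)
have := max z (s' ++ ACMvar x :: w); rewrite size_cat /=.
have -> : graft (ACMvar z) (s' ++ ACMvar x :: w) =
          graft (graft (ACMvar z) s') (ACMvar x :: w) by apply: foldl_cat.
move=> max0; case/eqP: gaw; rewrite /g (flip_sim_graft_swap _ _ _ Psi).
rewrite (flip_sim_graft _ as') max0 ?mulr0 //.
by rewrite -sm sw size_cat /= !addnS ltnS -add1n leq_add2r.
Qed.

Lemma comb_shuffle x u v : x \notin u -> x \notin v -> u != [::] -> v != [::] ->
  \sum_(w <- shuffles u v) coeff Psi (left_comb x w) = 0.
Proof.
move=> xu xv u0 v0.
rewrite -(big_map (map (@ACMvar X)) xpredT
            (fun w => coeff Psi (graft (ACMvar x) w))).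
rewrite -shuffles_map; apply: jacobian_shuffle; rewrite ?all_free //.
- by case: (u) u0.
- by case: (v) v0.
Qed.

(** Both sides are coefficients of Lie elements in the same letters, once [x] is
    renamed [y] on the right. They agree on the words that start with [y],
    where the claim is the antisymmetry of the innermost bracket {x, y}; hence
    they agree everywhere. *)
Lemma comb_swap_root x y u v :
  x != y -> x \notin u ++ v -> y \notin u ++ v ->
  coeff Psi (left_comb x (u ++ y :: v)) =
  - coeff Psi (left_comb y (u ++ x :: v)).
Proof.
move=> xy; rewrite !mem_cat !negb_or => /andP[xu xv] /andP[yu yv].
pose tau := tperm x y.
pose g w := coeff Psi (left_comb x w) + coeff Psi (left_comb y (map tau w)).
have tau_id w : all (fun z => (z != x) && (z != y)) w -> map tau w = w.
  move=> /allP Pw; rewrite -[RHS]map_id; apply/eq_in_map=> z /Pw/andP[zx zy].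
  by rewrite tpermD // eq_sym.
have avoid w : x \notin w -> y \notin w ->
    all (fun z => (z != x) && (z != y)) w.
  move=> xw yw; apply/allP=> z zw; apply/andP.
  by split; apply: contraTneq zw => ->.
suff : g (u ++ y :: v) = 0.
  rewrite /g map_cat /= tpermR !tau_id ?avoid //.
  by move/eqP; rewrite addr_eq0 => /eqP.
(* Words without [x] and [y] are fixed by [tau], which gives the value at words
   that start with [y]. *)
apply: (shuffle_vanishing (P := fun z => (z != x) && (z != y))
          (Q := fun z => z != x)); rewrite ?avoid //.
- by move=> z /andP[].
- by rewrite eq_sym.
- move=> u' v' u'0 v'0 xu' xv'; rewrite /g big_split /=.
  have nx w : all (fun z => z != x) w -> x \notin w.
    by move=> /allP Pw; apply/negP=> /Pw; rewrite eqxx.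
  have ny w : all (fun z => z != x) w -> y \notin map tau w.
    move=> /nx; apply: contra => /mapP[z zw yz].
    suff -> : x = z by [].
    by apply: (@perm_inj _ tau); rewrite -yz tpermL.
  rewrite comb_shuffle ?nx // add0r.
  rewrite -(big_map (map tau) xpredT (fun w => coeff Psi (left_comb y w))).
  rewrite -shuffles_map.
  by apply: comb_shuffle; rewrite ?ny //; [case: (u') u'0 | case: (v') v'0].
- move=> w Pw _; rewrite /g /= tpermR tau_id // (flip_sim_comb _ _ _ Psi).
  by rewrite mulN1r addNr.
Qed.

(** The transposition of [a] and [b] is a product of three exchanges with the
    letter at the bottom of the comb. *)
Lemma comb_alternating x u a b v :
  perm_eq (x :: u ++ a :: b :: v) (enum X) ->
  coeff Psi (left_comb x (u ++ a :: b :: v)) =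
  - coeff Psi (left_comb x (u ++ b :: a :: v)).
Proof.
move=> /perm_uniq; rewrite enum_uniq => U.
have {U} : uniq [:: x, a, b & u ++ v].
  rewrite (@perm_uniq _ _ (x :: u ++ [:: a, b & v])) // perm_cons.
  exact/permPl/(perm_catCA [:: a; b] u v).
rewrite /= !inE !mem_cat !negb_or -!andbA.
case/and5P=> xa xb xu xv /and5P[ab au av bu /andP[bv _]].
have [ax bx ba] : [/\ a != x, b != x & b != a] by rewrite !(eq_sym b) eq_sym.
have notinE := (mem_cat, mem_rcons, inE, negb_or,
  (xa, xb, xu, xv), (ab, au, av, bu, bv), (ax, bx, ba)).
rewrite comb_swap_root ?notinE // -cat_rcons comb_swap_root ?notinE // opprK.
by rewrite cat_rcons comb_swap_root ?notinE.
Qed.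

(** An alternating function that satisfies the shuffle relation of two letters
    with a nonempty rest vanishes in characteristic 0. *)
Lemma comb_size x l :
  [pchar k] =i pred0 -> coeff Psi (left_comb x l) != 0 -> (0 < size l <= 2)%N.
Proof.
move=> chark; case: l => [|a [|b [|c v]]] // nz.
  by rewrite jacobian_var // eqxx in nz.
have perm_l := comb_perm jacPsi.1 nz; case/eqP: nz.
have /= /andP[] := etrans (perm_uniq perm_l) (enum_uniq X).
rewrite !inE !negb_or => /and4P[xa xb xc xv] _.
pose h w := coeff Psi (left_comb x w).
have alt_h u (p q : X) w : perm_eq (u ++ p :: q :: w) [:: a, b, c & v] ->
    h (u ++ p :: q :: w) = - h (u ++ q :: p :: w).
  move=> perm_w; apply: comb_alternating.
  by apply: perm_trans perm_l; rewrite perm_cons.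
have := alternating_insert2 alt_h (u := [::]) (perm_refl _).
rewrite comb_shuffle ?inE ?negb_or ?xa ?xb ?xc // => /esym/eqP.
by rewrite mulf_eq0 ((pcharf0P k).1 chark) => /eqP.
Qed.
End Combs.

(** * Polylinear elements are determined by their coefficients *)

Lemma bracketZZ (k : fieldType) (A : acAlgType k) (a b : k) (F G : A) :
  bracket (a *: F) (b *: G) = (a * b) *: bracket F G.
Proof.
have Zl c (F' G' : A) : bracket (c *: F') G' = c *: bracket F' G'.
  have b0 : bracket 0 G' = 0 :> A.
    have /eqP := bracket_linearl 1 (0 : A) 0 G'.
    by rewrite !scale1r addr0 -subr_eq0 opprD addNKr oppr_eq0 => /eqP.
  by rewrite -[c *: F']addr0 bracket_linearl b0 addr0.
by rewrite Zl bracketC Zl -scalerN -bracketC scalerA.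
Qed.

Section Kernel.
Variables (k : fieldType) (X : eqType).
Local Notation tree := (ac_mono X).
Local Notation deg := ac_mono_deg.
Local Notation val := (ac_mono_val k).
Implicit Types (x y : X) (t p q r v w : tree) (L : seq (k * tree)).

Definition multilinear w := forall x, (deg x w <= 1)%N.

Lemma multilinear_br v w : multilinear (ACMbr v w) ->
  multilinear v /\ multilinear w.
Proof.
by move=> vw; split=> x; apply: leq_trans (vw x); rewrite ?leq_addr ?leq_addl.
Qed.

(** A tree on which both factors have a coefficient would have the variables of
    each of them, which are disjoint. *)
Lemma multilinear_disjoint v w t : multilinear (ACMbr v w) ->
  coeff (val v) t * coeff (val w) t = 0.
Proof.
move=> mvw; apply/eqP; apply: contraT; rewrite mulf_eq0 negb_or => /andP[vt wt].
have [x] := leaf_ex v; rewrite -lt0n => xv.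
have := mvw x; rewrite /= -(coeff_support x vt) (coeff_support x wt).
by rewrite -(coeff_support x wt) (coeff_support x vt); lia.
Qed.

(** For a multilinear monomial at most one of the two products in [coeff_br] is
    nonzero, so a nonzero coefficient is a sign that comes from flips. *)
Lemma coeff_mono_neq0 w t : multilinear w -> coeff (val w) t != 0 ->
  val w = (coeff (val w) t : k) *: val t.
Proof.
elim: w t => [y|v IHv w IHw] [z|p q] /= mw; rewrite ?coeff_var /= ?eqxx //.
- by case: (eqVneq y z) => [->|]; rewrite ?eqxx // scale1r.
- by rewrite coeff_bracket eqxx.
have [mv mw'] := multilinear_br mw; rewrite coeff_br.
have dp := multilinear_disjoint p mw; have dq := multilinear_disjoint q mw.
case: (eqVneq (coeff (val v) p) 0) => [vp|vp].
  rewrite vp mul0r sub0r oppr_eq0 mulf_eq0 negb_or => /andP[vq wp].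
  by rewrite bracketC {1}(IHv q) // {1}(IHw p) // bracketZZ scaleNr mulrC.
move: dp => /eqP; rewrite mulf_eq0 (negbTE vp) /= => /eqP wp.
rewrite wp mulr0 subr0 mulf_eq0 negb_or => /andP[_ wq].
by rewrite {1}(IHv p) // {1}(IHw q) // bracketZZ.
Qed.

Lemma coeff_mono_diag w : multilinear w -> coeff (val w) w = 1.
Proof.
elim: w => [y|v IHv w IHw] mw /=; first by rewrite coeff_var /= eqxx.
have [mv mw'] := multilinear_br mw; rewrite coeff_br IHv // IHw //.
have := multilinear_disjoint v mw; rewrite IHv // mul1r => ->.
by rewrite mulr0 mulr1 subr0.
Qed.

(** The terms proportional to a given monomial [w] add up to the coefficient at
    [w] times [w], so they can be removed together. *)
Lemma coeff_seq_inj L : (forall i, i \in L -> multilinear i.2) ->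
  (forall t, coeff (\sum_(i <- L) i.1 *: val i.2) t = 0) ->
  \sum_(i <- L) i.1 *: val i.2 = 0.
Proof.
have [n] := ubnP (size L); elim: n => // n IHn in L * => ltLn mL.
case: L => [|[c w] L] in ltLn mL *; first by rewrite big_nil.
set L1 := _ :: L in mL *; set F := \sum_(i <- L1) _ => F0.
pose near (i : k * tree) := coeff (val i.2) w != 0.
have sumF : F = \sum_(i <- L1 | near i) i.1 *: val i.2
                + \sum_(i <- filter (predC near) L1) i.1 *: val i.2.
  by rewrite big_filter /F (bigID near) /=.
have near0 : \sum_(i <- L1 | near i) i.1 *: val i.2 = 0.
  transitivity ((coeff F w : k) *: val w); last by rewrite F0 scale0r.
  rewrite coeff_sum scaler_suml [RHS](bigID near) /=.
  rewrite [X in _ = _ + X]big1 ?addr0 => [|i].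
    rewrite big_seq_cond [RHS]big_seq_cond.
    apply: eq_bigr => i /andP[/mL mi neari].
    by rewrite {1}(coeff_mono_neq0 mi neari) scalerA.
  by move/negbNE/eqP ->; rewrite mulr0 scale0r.
move: sumF; rewrite near0 add0r => sumF; rewrite sumF; apply: IHn.
- move: ltLn; rewrite ltnS -[size _]/(size L1) -(count_predC near L1).
  rewrite size_filter.
  have : (0 < count near L1)%N.
    rewrite -has_count /= /near coeff_mono_diag ?oner_neq0 //.
    by apply: (mL (c, w)); rewrite mem_head.
  by set m1 := count _ _; set m2 := count _ _; lia.
- by move=> i; rewrite mem_filter => /andP[_ /mL].
- by rewrite -sumF.
Qed.

Lemma polylinear_seq (F : freeAC k X) : polylinear F <->
  exists L, (forall i, i \in L -> forall x, deg x i.2 = 1%N) /\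
            F = \sum_(i <- L) i.1 *: val i.2.
Proof.
split=> [[r [c [w [wdeg ->]]]]|[L [Ldeg ->]]].
  exists [seq (c i, w i) | i <- enum 'I_r].
  split; last by rewrite big_map big_enum.
  by move=> _ /mapP[i _ ->] x; exact: wdeg.
exists (size L), (fun i => (tnth (in_tuple L) i).1).
exists (fun i => (tnth (in_tuple L) i).2).
split; last by rewrite big_tnth.
by move=> i x; apply: Ldeg; exact: mem_tnth.
Qed.

Lemma polylinear_inj (F : freeAC k X) :
  polylinear F -> (forall t, coeff F t = 0) -> F = 0.
Proof.
case/polylinear_seq=> L [Ldeg ->]; apply: coeff_seq_inj => i iL x.
by rewrite (Ldeg i iL).
Qed.

Lemma polylinear_linear (a : k) (F G : freeAC k X) :
  polylinear F -> polylinear G -> polylinear (a *: F + G).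
Proof.
case/polylinear_seq=> L [Ldeg ->]; case/polylinear_seq=> M [Mdeg ->].
apply/polylinear_seq; exists ([seq (a * i.1, i.2) | i <- L] ++ M); split.
  move=> i; rewrite mem_cat => /orP[/mapP[j jL ->]|]; last exact: Mdeg.
  exact: Ldeg jL.
rewrite big_cat big_map scaler_sumr; congr (_ + _).
by apply: eq_bigr => i _; rewrite scalerA.
Qed.

Lemma polylinear_mono w : (forall x, deg x w = 1%N) -> polylinear (val w).
Proof.
move=> wdeg; apply/polylinear_seq; exists [:: (1, w)].
by split=> [i|]; rewrite ?inE ?big_seq1 ?scale1r // => /eqP ->.
Qed.
End Kernel.

(** * Two and three variables *)

Section Small.
Variables (k : fieldType) (X : finType).
Implicit Types (F : freeAC k X).

(** With at most three leaves, one side of the root is a leaf and the other one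
    has at most two. *)
Lemma small_flip_sim_comb (t : ac_mono X) : (weight t <= 3)%N ->
  exists e x l, flip_sim k e t (left_comb x l).
Proof.
have thin (p : ac_mono X) (y : X) : (weight p <= 2)%N ->
    exists x l, ACMbr p (ACMvar y) = left_comb x l.
  case: p => [x _|p q]; first by exists x, [:: y].
  rewrite weight_br => pq2; have p0 := weight_gt0 p; have q0 := weight_gt0 q.
  have [|x ->] := @weight_eq1 _ p; first by lia.
  have [|z ->] := @weight_eq1 _ q; first by lia.
  by exists x, [:: z; y].
case: t => [x _|p q].
  by exists false, x, [::]; exact: flip_sim_refl.
rewrite weight_br => pq3; have p0 := weight_gt0 p; have q0 := weight_gt0 q.
have [q1 | q1] := eqVneq (weight q) 1%N.
  have [y ->] := weight_eq1 q1; have [|x [l ->]] := thin p y; first by lia.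
  by exists false, x, l; exact: flip_sim_refl.
have [|y ->] := @weight_eq1 _ p; first by lia.
have [|x [l qE]] := thin q y; first by lia.
by exists true, x, l; rewrite -qE; exact: flip_sim_root.
Qed.

Lemma polylinear_comb_inj F : (#|X| <= 3)%N -> polylinear F ->
  (forall x l, perm_eq (x :: l) (enum X) -> coeff F (left_comb x l) = 0) ->
  F = 0.
Proof.
move=> X3 polyF F0; apply: polylinear_inj => // t; apply/eqP.
apply: contraT => Ft.
have [e [x [l tl]]] : exists e x l, flip_sim k e t (left_comb x l).
  by apply: small_flip_sim_comb; rewrite (coeff_weight polyF Ft).
have nz : coeff F (left_comb x l) != 0.
  by apply: contraNneq Ft => w0; rewrite tl w0 mulr0.
by case/eqP: (nz); exact: F0 (comb_perm polyF nz).
Qed.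
End Small.

Lemma ord2P (x : 'I_2) : x = 0 \/ x = 1.
Proof. by case: x => [[|[|]]] // i; [left|right]; exact: val_inj. Qed.

Lemma ord3P (x : 'I_3) : [\/ x = 0, x = 1 | x = 2%:R].
Proof.
by case: x => [[|[|[|]]]] // i; [apply: Or31|apply: Or32|apply: Or33];
  exact: val_inj.
Qed.

Lemma C2E (k : fieldType) : C2 k = ac_mono_val k (left_comb (0 : 'I_2) [:: 1]).
Proof. by []. Qed.

Lemma C2_polylinear (k : fieldType) : polylinear (C2 k).
Proof.
by rewrite C2E; apply: polylinear_mono => x; case: (ord2P x) => ->.
Qed.

Lemma J3E (k : fieldType) : J3 k =
  ac_mono_val k (left_comb (0 : 'I_3) [:: 1; 2%:R]) +
  ac_mono_val k (left_comb (1 : 'I_3) [:: 2%:R; 0]) +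
  ac_mono_val k (left_comb (2%:R : 'I_3) [:: 0; 1]).
Proof. by []. Qed.

Lemma J3_polylinear (k : fieldType) : polylinear (J3 k).
Proof.
rewrite J3E -[_ + _ + _]scale1r scalerDr scalerDr -addrA.
have pl (x y z : 'I_3) : uniq [:: x; y; z] ->
    polylinear (ac_mono_val k (left_comb x [:: y; z])).
  move=> U; apply: polylinear_mono => w.
  by case: (ord3P w) U => ->; case: (ord3P x) => ->; case: (ord3P y) => ->;
    case: (ord3P z) => ->.
apply: polylinear_linear; first exact: pl.
apply: polylinear_linear; first exact: pl.
by rewrite scale1r; exact: pl.
Qed.

Lemma coeff_bracket3 (k : fieldType) (X : eqType) (a b c x y z : X) :
  coeff (bracket (bracket (ac_var k a) (ac_var k b)) (ac_var k c))
     (graft (ACMvar x) [:: ACMvar y; ACMvar z]) =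
  ((a == x)%:R * (b == y)%:R - (a == y)%:R * (b == x)%:R) * (c == z)%:R.
Proof.
by rewrite !coeff_bracket !coeff_var /bracket /= mul0r subr0.
Qed.

Lemma coeff_J3 (k : fieldType) (x y z : 'I_3) :
  coeff (J3 k) (left_comb x [:: y; z]) = - coeff (J3 k) (left_comb x [:: z; y]).
Proof.
rewrite /J3 !coeffD !coeff_bracket3.
by case: (ord3P x) => ->; case: (ord3P y) => ->; case: (ord3P z) => ->;
  rewrite /=; ring.
Qed.

Lemma coeff_J3_012 (k : fieldType) :
  coeff (J3 k) (left_comb 0 [:: 1; 2%:R]) = 1.
Proof. by rewrite /J3 !coeffD !coeff_bracket3 /=; ring. Qed.

Section Final.
Variables (k : fieldType).
Hypothesis chark : [pchar k] =i pred0.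

Lemma polylinear2 (Psi : freeAC k 'I_2) : polylinear Psi ->
  Psi = (coeff Psi (left_comb 0 [:: 1]) : k) *: C2 k.
Proof.
move=> polyPsi; set a : k := coeff _ _; apply/eqP; rewrite -subr_eq0; apply/eqP.
rewrite -scaleNr addrC; apply: polylinear_comb_inj; first by rewrite card_ord.
  exact: (polylinear_linear _ (C2_polylinear k) polyPsi).
have C01 : coeff (- a *: C2 k + Psi) (left_comb 0 [:: 1]) = 0.
  rewrite coeffD coeffZ C2E coeff_mono_diag ?mulr1 ?addNr // => x.
  by case: (ord2P x) => ->.
move=> x l /[dup] /perm_size; rewrite size_enum_ord.
case: l => [|y []] // _ /perm_uniq; rewrite enum_uniq.
case: (ord2P x) => ->; case: (ord2P y) => -> // _.
by rewrite (flip_sim_comb _ _ _ (- a *: C2 k + Psi)) C01 mulr0.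
Qed.

(** The coefficients of both sides at the six combs are alternating in the
    variables, and the difference is 0 at one comb. *)
Lemma jacobian3 (Psi : freeAC k 'I_3) : jacobian Psi ->
  Psi = (coeff Psi (left_comb 0 [:: 1; 2%:R]) : k) *: J3 k.
Proof.
move=> jacPsi; set a : k := coeff _ _; apply/eqP; rewrite -subr_eq0; apply/eqP.
rewrite -scaleNr addrC; apply: polylinear_comb_inj; first by rewrite card_ord.
  exact: (polylinear_linear _ (J3_polylinear k) jacPsi.1).
set G := _ + _.
pose c x y z := coeff G (left_comb x [:: y; z]).
have c012 : c 0 1 2%:R = 0 by rewrite /c coeffD coeffZ coeff_J3_012 mulr1 addNr.
have swap12 x y z : c x y z = - c y x z.
  by rewrite /c (flip_sim_comb _ _ _ G) mulN1r.
have swap23 x y z : perm_eq [:: x; y; z] (enum 'I_3) -> c x y z = - c x z y.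
  move=> xyz; rewrite /c !coeffD !coeffZ coeff_J3.
  have two0 : 2%:R != 0 :> k by rewrite ((pcharf0P k).1 chark).
  by rewrite (comb_alternating (u := [::]) two0 jacPsi xyz) /= mulrN -opprD.
move=> x l /[dup] /perm_size; rewrite size_enum_ord.
case: l => [|y [|z []]] // _ xyz; rewrite -/(c x y z).
have := perm_uniq xyz; rewrite enum_uniq.
have P (u v w : 'I_3) : uniq [:: u; v; w] -> perm_eq [:: u; v; w] (enum 'I_3).
  move=> U; apply: uniq_perm; rewrite ?enum_uniq // => i; rewrite mem_enum.
  by case: (ord3P u) U => ->; case: (ord3P v) => ->; case: (ord3P w) => ->;
    case: (ord3P i) => ->.
case: (ord3P x) => ->; case: (ord3P y) => ->; case: (ord3P z) => -> // _.
- by rewrite swap23 ?P // c012 oppr0.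
- by rewrite swap12 c012 oppr0.
- by rewrite swap23 ?P // swap12 c012 !oppr0.
- by rewrite swap12 swap23 ?P // c012 !oppr0.
- by rewrite swap12 swap23 ?P // swap12 c012 !oppr0.
Qed.
End Final.

Theorem theorem1 (k : fieldType) (chark : [pchar k] =i pred0) (n : nat)
    (Psi : freeAC k 'I_n) (Psi_neq0 : Psi != 0) (jacPsi : jacobian Psi) :
  exists2 alpha : k, alpha != 0 &
    (exists e : n = 2%N, ecast m (freeAC k 'I_m) e Psi = alpha *: C2 k) \/
    (exists e : n = 3%N, ecast m (freeAC k 'I_m) e Psi = alpha *: J3 k).
Proof.
have two0 : 2%:R != 0 :> k by rewrite ((pcharf0P k).1 chark).
have [t Psit] : exists t, coeff Psi t != 0.
  apply: contrapT => no_coeff; case/eqP: Psi_neq0.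
  apply: polylinear_inj jacPsi.1 _ => t; apply/eqP/negPn/negP => Psit.
  by apply: no_coeff; exists t.
have [x [l Psil]] := coeff_comb_neq0 two0 jacPsi Psit.
have nl : n = (size l).+1.
  by have /perm_size := comb_perm jacPsi.1 Psil; rewrite size_enum_ord.
have /andP[] := comb_size two0 jacPsi chark Psil.
case sl: (size l) nl => [|[|[|]]] // nE _ _; subst n.
- have PsiE := polylinear2 jacPsi.1; exists (coeff Psi (left_comb 0 [:: 1])).
    by apply: contraNneq Psi_neq0 => a0; rewrite PsiE a0 scale0r.
  by left; exists erefl.
- have PsiE := jacobian3 chark jacPsi.
  exists (coeff Psi (left_comb 0 [:: 1; 2%:R])).
    by apply: contraNneq Psi_neq0 => a0; rewrite PsiE a0 scale0r.
  by right; exists erefl.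
Qed.
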